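(* Let $H$ be a complex Hilbert space, $\lambda\in[0,1]$ and $T\in\mathcal{B}(H)$. The following assertions are equivalent: (i) $T$ is normaloid; (ii) $\|T\|\le\|\Delta_\lambda(XTX^{-1})\|$ for all invertible $X\in\mathcal{B}(H)$; (iii) $\|T\|\le\|\Delta_\lambda^n(XTX^{-1})\|$ for all invertible $X\in\mathcal{B}(H)$ and for all natural numbers $n$.
   Context: $H$ is a (nonzero) complex Hilbert space, $\mathcal{B}(H)$ is the space of bounded linear operators on $H$ with the operator norm $\|\cdot\|$, and $r(T)$ is the spectral radius of $T$. An operator $T$ is normaloid if $r(T)=\|T\|$. For $T\in\mathcal{B}(H)$, $|T|=(T^*T)^{1/2}$ and $T=U|T|$ is the unique polar decomposition, with $U$ the partial isometry satisfying $\ker U=\ker T$. For $\lambda\in[0,1]$ the $\lambda$-Aluthge transform is $\Delta_\lambda(T)=|T|^{\lambda}U|T|^{1-\lambda}$, with the convention $|T|^0=I$, so that $\Delta_0(T)=U|T|=T$ and $\Delta_1(T)=|T|U$. Its iterates are $\Delta_\lambda^0(T)=T$ and $\Delta_\lambda^{n+1}(T)=\Delta_\lambda(\Delta_\lambda^n(T))$. Natural numbers include $0$. *)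

(* Defs.v *)
From mathcomp Require Import all_boot all_order all_algebra.
From mathcomp Require Import all_classical all_reals all_analysis.
From mathcomp Require Import sesquilinear.
From mathcomp.real_closed Require Import complex.

Set Implicit Arguments.
Unset Strict Implicit.
Unset Printing Implicit Defensive.

Import Order.TTheory GRing.Theory Num.Theory.
Import numFieldNormedType.Exports.
Local Open Scope classical_set_scope.
Local Open Scope complex_scope.
Local Open Scope ring_scope.

Section BoundedOperators.
Context {R : realType} {H : completeNormedModType R[i]}.
Implicit Types (T S A B X Y : H -> H).

Definition bounded_op T :=
  linear T /\ exists M : R, forall x, `|T x| <= M%:C * `|x|.

(* Norms in a normed module over R[i] take their values in R[i]; they are real
   there, and [complex.Re] brings them back to R. *)
Definition opnorm T : R :=
  sup [set complex.Re `|T x| | x in [set x : H | `|x| <= 1]].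

Definition inverse_ops X Y :=
  [/\ bounded_op X, bounded_op Y, X \o Y = id & Y \o X = id].

Definition spectrum T : set R[i] :=
  [set z | ~ exists S, inverse_ops (fun x => T x - z *: x) S].

Definition spectral_radius T : R :=
  sup [set complex.Re `|z| | z in spectrum T].

Definition normaloid T := spectral_radius T = opnorm T.

Definition poly_op (p : {poly R}) A : H -> H :=
  fun x => \sum_(i < size p) (p`_i)%:C *: iter i A x.

(* Continuous functional calculus of a self-adjoint operator A (so that its
   spectrum is real): f(A) is the norm limit of the p(A), for p real polynomials
   tending to f uniformly on the spectrum of A. *)
Definition cfc A (f : R -> R) : H -> H :=
  get [set B | bounded_op B /\ forall e : R, 0 < e ->
    exists2 p : {poly R},
      forall t : R, spectrum A t%:C -> `|p.[t] - f t| <= e &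
      opnorm (fun x => poly_op p A x - B x) <= e].

(* As 0 `^ 0 = 1, op_pow A 0 is the identity also when A is not injective. *)
Definition op_pow A (s : R) : H -> H := cfc A (fun t => t `^ s).

End BoundedOperators.

Section Aluthge.
Context {R : realType} {H : completeNormedModType R[i]}.
Variable dot : {dot H for Num.conj}.
Implicit Types (T S A U : H -> H).

Definition adjoint T : H -> H :=
  get [set S | bounded_op S /\ forall x y, dot (T x) y = dot x (S y)].

Definition positive_op A := bounded_op A /\ forall x, 0 <= dot (A x) x.

Definition abs_op T : H -> H :=
  get [set A | positive_op A /\ A \o A = adjoint T \o T].

(* U is isometric on the orthogonal complement of its kernel. *)
Definition partial_isometry U := bounded_op U /\
  forall x, (forall y, U y = 0 -> dot x y = 0) -> `|U x| = `|x|.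

Definition polar_isometry T : H -> H :=
  get [set U | [/\ partial_isometry U, T = U \o abs_op T &
                   forall x, U x = 0 <-> T x = 0]].

Definition aluthge (lambda : R) T : H -> H :=
  op_pow (abs_op T) lambda \o polar_isometry T \o op_pow (abs_op T) (1 - lambda).

End Aluthge.

(* Main.v *)
Require Import Defs.
From mathcomp Require Import all_boot all_order all_algebra.
From mathcomp Require Import all_classical all_reals all_analysis.
From mathcomp Require Import sesquilinear.
From mathcomp.real_closed Require Import complex.
From mathcomp Require Import ring lra.

Set Implicit Arguments.
Unset Strict Implicit.
Unset Printing Implicit Defensive.

Import Order.TTheory GRing.Theory Num.Theory.
Import numFieldNormedType.Exports.
Local Open Scope complex_scope.
Local Open Scope ring_scope.

(* Write r for the spectral radius and D for the lambda-Aluthge transform. With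
   B = |T|^lambda and C = |T|^(1 - lambda), T = (U C) B and D(T) = B (U C) have
   the same nonzero spectrum, so r(T) = r(X T X^-1) bounds the norms of all the
   iterates of X T X^-1 from below: this is (i) => (iii). Conversely
   |D(S)| <= |S|, and Rota's theorem makes |X T X^-1| as close to r(T) as wanted,
   so (ii) gives |T| <= r(T).
   Rota's X is the square root of a sum of (T^k)^* T^k / rho^(2k) over k < n, where
   |T^n| <= rho^n. Such an n exists for every rho > r(T) by Rickart's argument,
   which proves the spectral radius formula without complex analysis. *)

(** The adjoint, the modulus, its powers and the polar isometry are all picked by [get], which
    guarantees nothing until an object with the stated property is shown to exist. Much of the work
    is therefore existence: projections and Riesz for the adjoint, polynomial approximation for the
    powers, closure of a graph for the polar isometry. Afterwards only the defining properties are
    used. The core of the functional calculus is that, for A symmetric, |p(A)| is at most any bound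
    of |p| on the spectrum of A. It comes from splitting p^2 - |p(A)|^2 into linear factors over the
    complex numbers. The obstacle in Rickart's argument is to pass on the smallness of (s T)^n with
    a constant that does not degrade with n. For n a power of two, the inverse of 1 - (s T)^n is an
    average of resolvents, whose Lipschitz constant in s is the same for all n. *)

(** * Real-valued norms, bounded operators and Neumann series *)

Section RealNorm.
Context {R : realType} {H : completeNormedModType R[i]}.
Implicit Types (x y z : H) (a b : R[i]) (T S E : H -> H) (M : R).

(** The norm of [H] lands in [R[i]], which is only partially ordered; its real counterpart gives
    access to suprema, to a total order and to [lra]. *)
Definition nrm x : R := complex.Re `|x|.
Definition cabs a : R := complex.Re `|a|.

Lemma nrmE x : `|x| = (nrm x)%:C.
Proof. by rewrite /nrm RRe_real // normr_real. Qed.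

Lemma cabsE a : `|a| = (cabs a)%:C.
Proof. by rewrite /cabs RRe_real // normr_real. Qed.

Lemma nrm_ge0 x : 0 <= nrm x.
Proof. by rewrite -ler0c -nrmE. Qed.

Lemma cabs_ge0 a : 0 <= cabs a.
Proof. by rewrite -ler0c -cabsE. Qed.

Lemma nrm0 : nrm 0 = 0 :> R.
Proof. by rewrite /nrm normr0. Qed.

Lemma nrm_eq0 x : nrm x = 0 -> x = 0.
Proof. by move=> x0; apply/eqP; rewrite -normr_eq0 nrmE x0. Qed.

Lemma nrm_gt0 x : x != 0 -> 0 < nrm x.
Proof.
by move=> x0; rewrite lt_def nrm_ge0 andbT; apply: contra_neq x0 => /nrm_eq0.
Qed.

Lemma nrmN x : nrm (- x) = nrm x.
Proof. by rewrite /nrm normrN. Qed.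

Lemma nrmBC x y : nrm (x - y) = nrm (y - x).
Proof. by rewrite /nrm distrC. Qed.

Lemma nrmD x y : nrm (x + y) <= nrm x + nrm y.
Proof. by rewrite -lecR rmorphD /= -!nrmE ler_normD. Qed.

Lemma nrmB x y : nrm (x - y) <= nrm x + nrm y.
Proof. by rewrite (le_trans (nrmD _ _))// nrmN. Qed.

Lemma nrm_dist z x y : nrm (x - y) <= nrm (x - z) + nrm (z - y).
Proof. by apply: le_trans (nrmD _ _); rewrite addrA subrK. Qed.

Lemma nrm_lerB x y : nrm x - nrm y <= nrm (x - y).
Proof. by rewrite lerBlDr (le_trans _ (nrmD _ _))// subrK. Qed.

Lemma nrmZ a x : nrm (a *: x) = cabs a * nrm x.
Proof. by apply: (@complexI R); rewrite rmorphM /= -!nrmE -cabsE normrZ. Qed.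

Lemma cabsM a b : cabs (a * b) = cabs a * cabs b.
Proof. by apply: (@complexI R); rewrite rmorphM /= -!cabsE normrM. Qed.

Lemma cabsX a n : cabs (a ^+ n) = cabs a ^+ n.
Proof. by apply: (@complexI R); rewrite rmorphXn /= -!cabsE normrX. Qed.

Lemma cabsV a : cabs (a^-1) = (cabs a)^-1.
Proof. by apply: (@complexI R); rewrite fmorphV /= -!cabsE normfV. Qed.

Lemma cabsN a : cabs (- a) = cabs a.
Proof. by rewrite /cabs normrN. Qed.

Lemma cabs_real (t : R) : cabs t%:C = `|t|.
Proof. by rewrite /cabs normc_def /= expr0n addr0 sqrtr_sqr. Qed.

Lemma cabs1 : cabs 1 = 1 :> R.
Proof. by rewrite /cabs normr1. Qed.

Lemma cabs_eq0 a : cabs a = 0 -> a = 0.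
Proof. by move=> a0; apply/eqP; rewrite -normr_eq0 cabsE a0. Qed.

Lemma cabs_gt0 a : a != 0 -> 0 < cabs a.
Proof.
by move=> a0; rewrite lt_def cabs_ge0 andbT; apply: contra_neq a0 => /cabs_eq0.
Qed.

Lemma nrm_eps0 x : (forall e : R, 0 < e -> nrm x <= e) -> x = 0.
Proof.
by move=> x0; apply: nrm_eq0; apply/le_anti; rewrite nrm_ge0 andbT; apply/ler_addgt0Pl => e /x0; rewrite addr0.
Qed.

Lemma cauchy_limit (u : nat -> H) :
  (forall e : R, 0 < e -> exists N, forall n, (N <= n)%N -> nrm (u n - u N) <= e) ->
  exists l, forall e : R, 0 < e -> exists N, forall n, (N <= n)%N -> nrm (u n - l) <= e.
Proof.
move=> cu; have : cvg (u @ \oo)%classic.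
  apply: cauchy_cvg; apply: cauchy_exP => -[e im] /[dup] /gtr0_real.
  rewrite complex_real => /eqP -> {im}; rewrite ltcR => e0.
  have [|N NP] := cu (e / 2); first by rewrite divr_gt0.
  exists (u N); exists N => // n /= Nn.
  rewrite -ball_normE /= nrmE ltcR nrmBC (le_lt_trans (NP _ Nn))//.
  by rewrite ltr_pdivrMr// mulr_natr mulr2n ltrDl.
move=> /cvg_ex [l ul]; exists l => e e0.
have /cvgrPdist_le /(_ e%:C) := ul.
rewrite ltcR => /(_ e0) [N _ NP]; exists N => n Nn.
by move: (NP n Nn) => /=; rewrite nrmE lecR nrmBC.
Qed.

Lemma inv_succ_small (e : R) : 0 < e ->
  exists N, forall n, (N <= n)%N -> n.+1%:R^-1 <= e.
Proof.
move=> e0; have /cvgr0Pnorm_le /(_ e e0) [N _ NP] := @cvg_harmonic R.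
by exists N => n Nn; have := NP n Nn; rewrite /= ger0_norm// invr_ge0.
Qed.

Lemma geometric_limit (u : nat -> H) (C q : R) : 0 <= q < 1 ->
  (forall n, nrm (u n.+1 - u n) <= C * q ^+ n) ->
  exists l, forall e : R, 0 < e -> exists N, forall n, (N <= n)%N -> nrm (u n - l) <= e.
Proof.
move=> /andP[q0 q1] uq; apply: cauchy_limit => e e0.
have C0 : 0 <= C by have := uq 0%N; rewrite mulr1; apply: le_trans; exact: nrm_ge0.
have p0 : 0 < 1 - q by rewrite subr_gt0.
(* The bound is C (q^N + ... + q^(N + k - 1)) in closed form, which is what an induction on [k] can
   carry. *)
have dist N k : nrm (u (k + N)%N - u N) <= C * q ^+ N / (1 - q) * (1 - q ^+ k).
  elim: k => [|k IH]; first by rewrite subrr nrm0 expr0 subrr mulr0.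
  rewrite addSn (le_trans (nrm_dist (u (k + N)%N) _ _))//.
  rewrite (le_trans (lerD (uq _) IH))// exprD exprS le_eqVlt; apply/orP; left.
  by apply/eqP; field; rewrite gt_eqF.
have : (C * q ^+ n @[n --> \oo] --> (C * 0))%classic.
  by apply: cvgM; [exact: cvg_cst|apply: cvg_expr; rewrite ger0_norm].
rewrite mulr0 => /cvgr0Pnorm_le /(_ (e * (1 - q))).
rewrite mulr_gt0// => /(_ isT) [N _ NP]; exists N => n Nn.
have := dist N (n - N)%N; rewrite subnK// => /le_trans; apply.
rewrite (@le_trans _ _ (C * q ^+ N / (1 - q)))//.
  rewrite ler_piMr// ?divr_ge0 ?mulr_ge0 ?exprn_ge0 ?(ltW p0)//.
  by rewrite gerBl exprn_ge0.
rewrite ler_pdivrMr//; have := NP N (leqnn _).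
by rewrite ger0_norm// mulr_ge0 ?exprn_ge0.
Qed.

Definition opbd M T := forall x, nrm (T x) <= M * nrm x.

Lemma linopD T : linear T -> {morph T : x y / x + y}.
Proof. by move=> lT x y; have := lT 1 x y; rewrite !scale1r. Qed.

Lemma linop0 T : linear T -> T 0 = 0.
Proof. by move=> lT; apply: (addIr (T 0)); rewrite -linopD// !add0r. Qed.

Lemma linopZ T : linear T -> forall a x, T (a *: x) = a *: T x.
Proof. by move=> lT a x; have := lT a x 0; rewrite (linop0 lT) !addr0. Qed.

Lemma linopN T : linear T -> {morph T : x / - x}.
Proof. by move=> lT x; rewrite -scaleN1r linopZ// scaleN1r. Qed.

Lemma linopB T : linear T -> {morph T : x y / x - y}.
Proof. by move=> lT x y; rewrite linopD// linopN. Qed.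

Lemma bounded_opP T : bounded_op T <-> linear T /\ exists2 M, 0 <= M & opbd M T.
Proof.
split=> [[lT [M TM]]|[lT [M M0 TM]]]; split=> //; last first.
  by exists M => x; rewrite !nrmE -rmorphM lecR.
exists `|M| => // x; rewrite (@le_trans _ _ (M * nrm x))//.
  by rewrite -lecR rmorphM /= -!nrmE.
by rewrite ler_wpM2r ?nrm_ge0// ler_norm.
Qed.

Lemma bounded_op_lin T : bounded_op T -> linear T.
Proof. by case. Qed.

Lemma opnorm_hassup T M : linear T -> 0 <= M -> opbd M T ->
  has_sup [set complex.Re `|T x| | x in [set x : H | `|x| <= 1]]%classic.
Proof.
move=> lT M0 TM; split; first by exists (nrm (T 0)), 0; rewrite //= normr0.
exists M => _ [x /= x1 <-]; rewrite (le_trans (TM x))//.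
by rewrite ler_piMr//; move: x1; rewrite nrmE lecR.
Qed.

Lemma opnorm_ge0 T : bounded_op T -> 0 <= opnorm T.
Proof.
move=> /bounded_opP [lT [M M0 TM]].
have [_ ub] := opnorm_hassup lT M0 TM.
rewrite (@le_trans _ _ (nrm (T 0))) ?nrm_ge0//.
by apply: (ub_le_sup ub); exists 0; rewrite //= normr0.
Qed.

Lemma opnorm_bd T : bounded_op T -> opbd (opnorm T) T.
Proof.
move=> /bounded_opP [lT [M M0 TM]] x.
have [_ ub] := opnorm_hassup lT M0 TM.
have [->|x0] := eqVneq x 0; first by rewrite linop0// nrm0 mulr0.
have nx0 := nrm_gt0 x0.
rewrite -ler_pdivrMr//; apply: (ub_le_sup ub).
exists ((nrm x)^-1%:C *: x).
  by rewrite /= nrmE lecR nrmZ cabs_real ger0_norm ?invr_ge0 ?(ltW nx0)// mulVf ?gt_eqF.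
rewrite linopZ// -/(nrm _) nrmZ cabs_real ger0_norm ?invr_ge0 ?(ltW nx0)//.
by rewrite mulrC.
Qed.

Lemma opnorm_le T M : linear T -> 0 <= M -> opbd M T -> opnorm T <= M.
Proof.
move=> lT M0 TM; have [ne _] := opnorm_hassup lT M0 TM.
apply: sup_le_ub => // _ [x /= x1 <-]; rewrite (le_trans (TM x))//.
by rewrite ler_piMr//; move: x1; rewrite nrmE lecR.
Qed.

Lemma opbd_comp M N T S : 0 <= M -> opbd M T -> opbd N S -> opbd (M * N) (T \o S).
Proof.
move=> M0 TM SN x /=; rewrite (le_trans (TM _))// -mulrA ler_wpM2l//.
Qed.

Lemma linop_comp T S : linear T -> linear S -> linear (T \o S).
Proof. by move=> lT lS a x y /=; rewrite lS lT. Qed.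

Lemma bounded_op_comp T S : bounded_op T -> bounded_op S -> bounded_op (T \o S).
Proof.
move=> /bounded_opP[lT [M M0 TM]] /bounded_opP[lS [N N0 SN]].
apply/bounded_opP; split; first exact: linop_comp.
by exists (M * N); [exact: mulr_ge0|exact: opbd_comp].
Qed.

Lemma bounded_op_id : bounded_op (@id H).
Proof. by apply/bounded_opP; split => //; exists 1 => // x; rewrite mul1r. Qed.

Lemma bounded_opD a T S : bounded_op T -> bounded_op S ->
  bounded_op (fun x => T x + a *: S x).
Proof.
move=> /bounded_opP[lT [M M0 TM]] /bounded_opP[lS [N N0 SN]].
apply/bounded_opP; split.
  move=> b x y /=; rewrite lT lS scalerDr !scalerDr !scalerA [b * a]mulrC.
  by rewrite addrACA.
exists (M + cabs a * N); first by rewrite addr_ge0 ?mulr_ge0 ?cabs_ge0.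
move=> x; rewrite (le_trans (nrmD _ _))// nrmZ mulrDl lerD// -mulrA.
by rewrite ler_wpM2l ?cabs_ge0.
Qed.

Lemma bounded_opB a T : bounded_op T -> bounded_op (fun x => T x - a *: x).
Proof.
move=> bT; have := bounded_opD (- a) bT bounded_op_id.
by congr bounded_op; apply/funext => x; rewrite scaleNr.
Qed.

(** The lower bound yields injectivity and bounds the inverse by 1/c at once, so a pointwise choice
    of preimages is already a bounded operator. *)
Lemma bounded_below_inverse T (c : R) : bounded_op T -> 0 < c ->
  (forall x, c * nrm x <= nrm (T x)) -> (forall y, exists x, T x = y) ->
  exists S, inverse_ops T S.
Proof.
move=> bT c0 Tc /choice[S TS]; have lT := bounded_op_lin bT.
have inj x y : T x = T y -> x = y.
  move=> Txy; apply: subr0_eq; apply: nrm_eq0; apply/le_anti.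
  by rewrite nrm_ge0 andbT -(pmulr_rle0 _ c0) (le_trans (Tc _))// linopB// Txy subrr nrm0.
exists S; split => //; last 2 first.
- by apply/funext => x; exact: TS.
- by apply/funext => x; apply: inj; exact: TS.
apply/bounded_opP; split.
  by move=> a x y; apply: inj; rewrite lT !TS.
exists c^-1; first by rewrite invr_ge0 ltW.
by move=> x; rewrite mulrC ler_pdivlMr// mulrC (le_trans (Tc _))// TS.
Qed.

(** The iterates of x |-> y + E x from 0 are the partial sums of the Neumann series: consecutive
    ones differ by E^n y, of norm at most q^n |y|. *)
Lemma neumann_fixpoint E (q : R) y : linear E -> 0 <= q < 1 -> opbd q E ->
  exists x, x - E x = y.
Proof.
move=> lE /[dup] q01 /andP[q0 q1] Eq.
pose u n := iter n (fun x => y + E x) 0.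
have [|l ul] := @geometric_limit u (nrm y) q q01.
  elim=> [|n IH]; first by rewrite /u /= subr0 linop0// addr0 mulr1.
  rewrite [u n.+2]/= [in X in _ - X]/= opprD addrACA subrr add0r -linopB//.
  by rewrite (le_trans (Eq _))// exprS mulrCA ler_wpM2l.
exists l; apply: subr0_eq; apply: nrm_eps0 => e e0.
have [|N NP] := ul (e / 2); first by rewrite divr_gt0.
have -> : l - E l - y = (l - u N.+1) + E (u N - l).
  by rewrite linopB//= opprD !addrA subrK addrAC.
rewrite (le_trans (nrmD _ _))// [e]splitr lerD//; first by rewrite nrmBC NP.
by rewrite (le_trans (Eq _))// (le_trans _ (NP N (leqnn _)))// ler_piMl ?nrm_ge0 ?ltW.
Qed.

Lemma neumann_inverse E (q : R) : bounded_op E -> 0 <= q < 1 -> opbd q E ->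
  exists S, inverse_ops (fun x => x - E x) S.
Proof.
move=> bE /[dup] q01 /andP[q0 q1] Eq.
apply: (@bounded_below_inverse _ (1 - q)); last 1 first.
- by move=> y; exact: neumann_fixpoint (bounded_op_lin bE) q01 Eq.
- have := bounded_opD (- 1) bounded_op_id bE.
  by congr bounded_op; apply/funext => x; rewrite scaleN1r.
- by rewrite subr_gt0.
- move=> x; rewrite mulrBl mul1r (le_trans _ (nrm_lerB _ _))//.
  by rewrite lerB.
Qed.

Lemma inverse_opsZ a T S : a != 0 -> inverse_ops T S ->
  inverse_ops (fun x => a *: T x) (fun x => S (a^-1 *: x)).
Proof.
have bZ b V : bounded_op V -> bounded_op (fun x => b *: V x).
  move=> /bounded_opP[lV [M M0 VM]]; apply/bounded_opP; split.
    by move=> c x y; rewrite lV scalerDr !scalerA mulrC.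
  exists (cabs b * M); first by rewrite mulr_ge0 ?cabs_ge0.
  by move=> x; rewrite nrmZ -mulrA ler_wpM2l ?cabs_ge0.
move=> a0 [bT bS TS ST]; have lS := bounded_op_lin bS; split => //.
- exact: bZ.
- by have := bZ a^-1 _ bS; congr bounded_op; apply/funext => x; rewrite linopZ.
- apply/funext => x /=; have /(congr1 (@^~ (a^-1 *: x))) /= -> := TS.
  by rewrite scalerA divff// scale1r.
- apply/funext => x /=; rewrite scalerA mulVf// scale1r.
  exact: (congr1 (@^~ x) ST).
Qed.

Lemma inverse_ops_comp T S T' S' : inverse_ops T S -> inverse_ops T' S' ->
  inverse_ops (T \o T') (S' \o S).
Proof.
move=> [bT bS TS ST] [bT' bS' TS' ST']; split; try exact: bounded_op_comp.
- by rewrite -compA [T' \o _]compA TS'.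
- by rewrite -compA [S \o _]compA ST.
Qed.

(** If |z| > M, then T - z = - z (1 - T / z), where T / z is a contraction of ratio M / |z|. *)
Lemma spectrum_bound T (M : R) (z : R[i]) : bounded_op T -> 0 <= M -> opbd M T ->
  spectrum T z -> cabs z <= M.
Proof.
move=> bT M0 TM sz; rewrite leNgt; apply/negP => Mz; apply: sz.
have z0 : 0 < cabs z by exact: le_lt_trans Mz.
have zn0 : z != 0 by apply: contraTneq z0 => ->; rewrite /cabs normr0 ltxx.
have bE : bounded_op (fun x => z^-1 *: T x).
  (* [bounded_opD] scales only its second term, so z^-1 T is written T + (z^-1 - 1) T. *)
  have := @bounded_opD (z^-1 - 1) T T bT bT; congr bounded_op.
  by apply/funext => x; rewrite scalerBl scale1r addrC subrK.
have [] := @neumann_inverse _ (M / cabs z) bE.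
- by rewrite divr_ge0 ?cabs_ge0//= ltr_pdivrMr// mul1r.
- move=> x; rewrite nrmZ cabsV mulrC mulrAC ler_wpM2r ?invr_ge0 ?cabs_ge0//.
move=> S /(@inverse_opsZ (- z)); rewrite oppr_eq0 => /(_ zn0) TS; eexists.
move: TS; congr (inverse_ops _ _); apply/funext => x.
by rewrite scaleNr scalerBr opprB scalerA divff// scale1r.
Qed.

End RealNorm.

(** * The real inner product: coercivity, projections, Riesz representation, adjoints *)

Section RealDot.
Context {R : realType} {H : completeNormedModType R[i]}.
Variable dot : {dot H for Num.conj}.
Hypothesis dot_norm : forall x : H, `|x| ^+ 2 = dot x x.
Implicit Types (x y z : H) (a b : R[i]) (t : R) (T S A : H -> H).

(** A symmetric real bilinear form with the same norm, so that projection and representation can be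
    argued over [R]; [dotE] recovers the complex form from it. *)
Definition rdot x y : R := complex.Re (dot x y).

Lemma dotZl a x y : dot (a *: x) y = a * dot x y.
Proof. exact: linearZl_LR. Qed.

Lemma dotZr a x y : dot x (a *: y) = a^*%C * dot x y.
Proof. exact: linearZr_LR. Qed.

Lemma rdotC x y : rdot x y = rdot y x.
Proof.
rewrite /rdot; have -> : dot x y = (dot y x)^*%C by rewrite hermC expr0 mul1r.
by case: (dot y x).
Qed.

Lemma rdotDl z : {morph rdot^~ z : x y / x + y}.
Proof. by move=> x y; rewrite /rdot linearDl raddfD. Qed.

Lemma rdotDr z : {morph rdot z : x y / x + y}.
Proof. by move=> x y; rewrite ![rdot z _]rdotC rdotDl. Qed.

Lemma rdotNl x y : rdot (- x) y = - rdot x y.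
Proof. by rewrite /rdot linearNl raddfN. Qed.

Lemma rdotNr x y : rdot x (- y) = - rdot x y.
Proof. by rewrite ![rdot x _]rdotC rdotNl. Qed.

Lemma rdotBl z : {morph rdot^~ z : x y / x - y}.
Proof. by move=> x y; rewrite rdotDl rdotNl. Qed.

Lemma rdotBr z : {morph rdot z : x y / x - y}.
Proof. by move=> x y; rewrite rdotDr rdotNr. Qed.

Lemma rdot0l x : rdot 0 x = 0.
Proof. by rewrite /rdot linear0l. Qed.

Lemma rdotZl t x y : rdot (t%:C *: x) y = t * rdot x y.
Proof. by rewrite /rdot dotZl; case: (dot x y) => u v; simpc. Qed.

Lemma rdotZr t x y : rdot x (t%:C *: y) = t * rdot x y.
Proof. by rewrite ![rdot x _]rdotC rdotZl. Qed.

Lemma rdotZC a x y : rdot (a *: x) y = rdot x (a^*%C *: y).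
Proof.
rewrite /rdot dotZl dotZr.
by case: a (dot x y) => a a' [u v]; simpc => /=; ring.
Qed.

Lemma rdotZCr a x y : rdot x (a *: y) = rdot (a^*%C *: x) y.
Proof. by rewrite rdotZC conjcK. Qed.

Lemma rdot_suml I (r : seq I) (F : I -> H) y :
  rdot (\sum_(i <- r) F i) y = \sum_(i <- r) rdot (F i) y.
Proof.
by elim/big_rec2: _ => [|i u v _ <-]; rewrite ?rdot0l// rdotDl.
Qed.

Lemma rdotxx x : rdot x x = nrm x ^+ 2.
Proof. by rewrite /rdot -dot_norm nrmE -rmorphXn. Qed.

Lemma rdot_ge0 x : 0 <= rdot x x.
Proof. by rewrite rdotxx sqr_ge0. Qed.

Lemma dotE x y : dot x y = rdot x y +i* (- rdot ('i *: x) y).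
Proof. by rewrite /rdot dotZl; case: (dot x y) => u v; simpc. Qed.

Lemma rdot_inj y z : (forall x, rdot x y = rdot x z) -> y = z.
Proof.
move=> yz; apply: subr0_eq; apply: nrm_eq0; apply/eqP.
by rewrite -sqrf_eq0 -rdotxx rdotBr yz subrr.
Qed.

Lemma nrm_sqD x y : nrm (x + y) ^+ 2 = nrm x ^+ 2 + 2 * rdot x y + nrm y ^+ 2.
Proof. by rewrite -!rdotxx rdotDl !rdotDr [rdot y x]rdotC; ring. Qed.

Lemma nrm_sqB x y : nrm (x - y) ^+ 2 = nrm x ^+ 2 - 2 * rdot x y + nrm y ^+ 2.
Proof. by rewrite nrm_sqD nrmN rdotNr mulrN. Qed.

Lemma rdot_le x y : rdot x y <= nrm x * nrm y.
Proof.
have [->|x0] := eqVneq x 0; first by rewrite rdot0l nrm0 mul0r.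
have [->|y0] := eqVneq y 0; first by rewrite rdotC rdot0l nrm0 mulr0.
have := sqr_ge0 (nrm ((nrm y)%:C *: x - (nrm x)%:C *: y)).
rewrite nrm_sqB !nrmZ !cabs_real !ger0_norm ?nrm_ge0// rdotZl rdotZr.
have := nrm_gt0 x0; have := nrm_gt0 y0; move: (nrm x) (nrm y) => u v v0 u0 h.
rewrite -(ler_pM2l (mulr_gt0 u0 v0)) -subr_ge0 -(@pmulr_lge0 _ 2)//.
by apply: le_trans h _; rewrite le_eqVlt; apply/orP; left; apply/eqP; ring.
Qed.

Lemma rdot_abs_le x y : `|rdot x y| <= nrm x * nrm y.
Proof.
rewrite ler_norml rdot_le andbT lerNl -rdotNr -[nrm y]nrmN.
exact: rdot_le.
Qed.

(** This is the Lax-Milgram argument: T x = y says that x - E x = tau y with E = 1 - tau T, and |E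
    x|^2 <= (1 - 2 tau c + tau^2 M^2) |x|^2. *)
Lemma coercive_inverse T (c : R) : bounded_op T -> 0 < c ->
  (forall x, c * nrm x ^+ 2 <= rdot (T x) x) -> exists S, inverse_ops T S.
Proof.
move=> bT c0 Tc; have [lT [M0 M00 TM0]] := (bounded_opP T).1 bT.
(* Enlarging the bound of T gives M > 0 and c <= M, so that 1 - (c / M)^2 is nonnegative and has a
   square root to serve as contraction ratio. *)
pose M := M0 + c; have cM : c <= M by rewrite lerDr.
have M_gt0 : 0 < M by exact: lt_le_trans cM.
have TM x : nrm (T x) <= M * nrm x.
  by rewrite (le_trans (TM0 x))// ler_wpM2r ?nrm_ge0// lerDl ltW.
(* The minimiser of 1 - 2 tau c + tau^2 M^2, whose minimum is [q2]. *)
pose tau := c / M ^+ 2; have tau0 : 0 < tau by rewrite divr_gt0 ?exprn_gt0.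
pose E x := x - tau%:C *: T x.
have lE : linear E.
  move=> a x y; rewrite /E lT scalerDr opprD addrACA scalerBr; congr (_ - _ + _).
  by rewrite !scalerA mulrC.
pose q2 := 1 - (c / M) ^+ 2.
have q201 : 0 <= q2 < 1.
  rewrite /q2 subr_ge0 gtrBl exprn_gt0 ?divr_gt0// andbT.
  by rewrite exprn_ile1 ?divr_ge0 ?(ltW c0) ?(ltW M_gt0)// ler_pdivrMr// mul1r.
have Eq : opbd (Num.sqrt q2) E.
  move=> x; rewrite -(@ler_pXn2r _ 2)// ?nnegrE ?mulr_ge0 ?sqrtr_ge0 ?nrm_ge0//.
  rewrite exprMn sqr_sqrtr; last by case/andP: q201.
  rewrite nrm_sqB rdotZr rdotC nrmZ cabs_real gtr0_norm// exprMn.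
  have h1 : tau * (c * nrm x ^+ 2) <= tau * rdot (T x) x by rewrite ler_wpM2l ?(ltW tau0).
  have h2 : tau ^+ 2 * nrm (T x) ^+ 2 <= tau ^+ 2 * (M * nrm x) ^+ 2.
    by rewrite ler_wpM2l ?sqr_ge0// ler_pXn2r ?nnegrE ?mulr_ge0 ?nrm_ge0 ?(ltW M_gt0)//.
  have -> : q2 * nrm x ^+ 2 =
      nrm x ^+ 2 - 2 * (tau * (c * nrm x ^+ 2)) + tau ^+ 2 * (M * nrm x) ^+ 2.
    by rewrite /q2 /tau; field; rewrite gt_eqF.
  by rewrite lerD// lerD2l lerN2 ler_pM2l.
have sq1 : 0 <= Num.sqrt q2 < 1.
  by rewrite sqrtr_ge0 /= -sqrtr1 ltr_sqrt//; case/andP: q201.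
apply: (bounded_below_inverse bT c0) => [x|y].
  have [->|x0] := eqVneq x 0; first by rewrite nrm0 mulr0 nrm_ge0.
  have nx0 := nrm_gt0 x0.
  rewrite -(ler_pM2r nx0) -mulrA -expr2 (le_trans (Tc x))// rdot_le//.
have [x xy] := neumann_fixpoint (tau%:C *: y) lE sq1 Eq.
exists x; move: xy; rewrite /E opprB addrC subrK => /(congr1 (fun z => tau^-1%:C *: z)).
by rewrite !scalerA -rmorphM mulVf ?gt_eqF// !scale1r.
Qed.

(* A real subspace need not be closed: the projection lies in its closure. *)
Lemma projection (D : H -> Prop) x : D 0 ->
  (forall t y z, D y -> D z -> D (t%:C *: y + z)) ->
  exists m, (forall e : R, 0 < e -> exists2 d, D d & nrm (m - d) <= e) /\
            forall d, D d -> rdot (x - m) d = 0.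
Proof.
move=> D0 DD.
pose V := [set nrm (x - d) ^+ 2 | d in D]%classic.
have V0 : has_inf V.
  split; first by exists (nrm (x - 0) ^+ 2), 0.
  by exists 0 => _ [d _ <-]; exact: sqr_ge0.
(* A point whose squared distance to x is within e^2 of the infimum is almost a critical point: the
   residual x - d is orthogonal to [D] up to e. *)
have approx (e : R) : 0 < e ->
    exists2 d, D d & forall d', D d' -> `|rdot (x - d) d'| <= e * nrm d'.
  move=> e0; have e20 : 0 < e ^+ 2 by rewrite exprn_gt0.
  have [_ [d Dd <-] dlt] := inf_adherent e20 V0.
  exists d => // d' Dd'; set r := rdot _ _.
  have h t : 2 * t * r <= e ^+ 2 + t ^+ 2 * nrm d' ^+ 2.
    have : inf V <= nrm (x - (t%:C *: d' + d)) ^+ 2.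
      by apply: ge_inf; [exact: V0.2|exists (t%:C *: d' + d) => //; exact: DD].
    rewrite [t%:C *: _ + _]addrC opprD addrA nrm_sqB rdotZr -/r nrmZ cabs_real exprMn.
    by rewrite real_normK ?num_real//; move: dlt; set u := nrm (x - d) ^+ 2; lra.
  have [d0|d0] := eqVneq (nrm d') 0.
    by rewrite /r (nrm_eq0 d0) rdotC rdot0l nrm0 mulr0 normr0.
  have {}d0 : 0 < nrm d' by rewrite lt_def d0 nrm_ge0.
  rewrite -(@ler_pXn2r _ 2)// ?nnegrE ?mulr_ge0 ?nrm_ge0 ?(ltW e0)//.
  rewrite real_normK ?num_real// exprMn -ler_pdivrMr ?exprn_gt0//.
  (* The value of t that makes the inequality [h] sharpest. *)
  have := h (r / nrm d' ^+ 2).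
  have -> : 2 * (r / nrm d' ^+ 2) * r = 2 * (r ^+ 2 / nrm d' ^+ 2) by ring.
  have -> : (r / nrm d' ^+ 2) ^+ 2 * nrm d' ^+ 2 = r ^+ 2 / nrm d' ^+ 2.
    by field; rewrite gt_eqF.
  by lra.
have inv_gt0 n : 0 < n.+1%:R^-1 :> R by rewrite invr_gt0 ltr0n.
have /choice[u uP] n : exists d, D d /\
    forall d', D d' -> `|rdot (x - d) d'| <= n.+1%:R^-1 * nrm d'.
  by have [d] := approx _ (inv_gt0 n); exists d.
have DB y z : D y -> D z -> D (y - z).
  by move=> Dy Dz; have := DD (-1) _ _ Dz Dy; rewrite rmorphN scaleN1r addrC.
(* Almost orthogonality alone makes the sequence Cauchy: |u n - u k|^2 is the product of u n - u k
   with a difference of two residuals, each almost orthogonal to it. *)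
have dist n k : nrm (u n - u k) <= n.+1%:R^-1 + k.+1%:R^-1.
  have [->|d0] := eqVneq (nrm (u n - u k)) 0; first by rewrite addr_ge0 ?ltW.
  have {}d0 : 0 < nrm (u n - u k) by rewrite lt_def d0 nrm_ge0.
  rewrite -(ler_pM2r d0) -expr2 -rdotxx.
  have Dnk : D (u n - u k) by apply: DB; [exact: (uP n).1|exact: (uP k).1].
  have {1}-> : u n - u k = (x - u k) - (x - u n).
    by rewrite opprB [RHS]addrC addrA subrK.
  rewrite rdotBl mulrDl addrC lerD//.
    by rewrite lerNl; exact: lerNnormlW ((uP n).2 _ Dnk).
  exact: le_trans (ler_norm _) ((uP k).2 _ Dnk).
have [|m um] := @cauchy_limit _ _ u.
  move=> e e0; have [|N NP] := @inv_succ_small _ (e / 2); first by rewrite divr_gt0.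
  by exists N => n Nn; rewrite (le_trans (dist _ _))// [e]splitr lerD ?NP.
exists m; split=> [e /um[N NP]|d Dd].
  by exists (u N); [exact: (uP N).1|rewrite nrmBC NP].
apply/eqP; rewrite -normr_eq0 eq_le normr_ge0 andbT.
apply/ler_addgt0Pl => e e0; rewrite addr0.
have p0 : 0 < nrm d + 1 by rewrite ltr_wpDl ?nrm_ge0.
pose e' := e / (nrm d + 1) / 2; have e'0 : 0 < e' by rewrite !divr_gt0.
have [N1 N1P] := um _ e'0; have [N2 N2P] := inv_succ_small e'0.
pose N := maxn N1 N2.
have -> : x - m = (x - u N) + (u N - m) by rewrite addrA subrK.
rewrite rdotDl (le_trans (ler_normD _ _))//.
have h1 : `|rdot (x - u N) d| <= e' * nrm d.
  apply: le_trans ((uP N).2 _ Dd) _.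
  by rewrite ler_wpM2r ?nrm_ge0// N2P// leq_maxr.
have h2 : `|rdot (u N - m) d| <= e' * nrm d.
  by rewrite (le_trans (rdot_abs_le _ _))// ler_wpM2r ?nrm_ge0// N1P// leq_maxl.
rewrite (le_trans (lerD h1 h2))//.
have -> : e = e' * (nrm d + 1) + e' * (nrm d + 1).
  by rewrite /e'; field; rewrite gt_eqF.
by rewrite lerD// ler_wpM2l ?(ltW e'0)// lerDl.
Qed.

(** Boundedness puts the projection m of x0 on ker g back in ker g, so w = x0 - m is orthogonal to
    ker g with g w <> 0. Orthogonality to x - (g x / g w) w, which lies in ker g, then expresses g x
    through the product of x with w. *)
Lemma riesz (g : H -> R) (M : R) :
  (forall t x y, g (t%:C *: x + y) = t * g x + g y) ->
  (forall x, `|g x| <= M * nrm x) -> exists z, forall x, g x = rdot x z.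
Proof.
move=> lg gM.
have g0 : g 0 = 0.
  by have := gM 0; rewrite nrm0 mulr0 normr_le0 => /eqP.
have [[x0 gx0]|no] := pselect (exists x0, g x0 != 0); last first.
  exists 0 => x; rewrite rdotC rdot0l; apply/eqP/negPn/negP => gx.
  by apply: no; exists x.
have [|m [mcl mort]] := @projection (fun x => g x = 0) x0 g0.
  by move=> t y z gy gz; rewrite lg gy gz mulr0 addr0.
have gm : g m = 0.
  apply/eqP; rewrite -normr_eq0 eq_le normr_ge0 andbT.
  apply/ler_addgt0Pl => e e0; rewrite addr0.
  have p0 : 0 < `|M| + 1 by rewrite ltr_wpDl.
  have [|d gd md] := mcl (e / (`|M| + 1)); first by rewrite divr_gt0.
  have -> : g m = g (m - d).
    have := lg (-1) d m; rewrite gd mulr0 add0r => <-.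
    by rewrite rmorphN scaleN1r addrC.
  rewrite (le_trans (gM _))// (@le_trans _ _ ((`|M| + 1) * nrm (m - d)))//.
    by rewrite ler_wpM2r ?nrm_ge0// (le_trans (ler_norm _))// lerDl.
  by rewrite mulrC -ler_pdivlMr.
set w := x0 - m in mort.
have gw : g w != 0.
  have -> // : g w = g x0.
  have := lg (-1) m x0; rewrite gm mulr0 add0r => <-.
  by rewrite rmorphN scaleN1r addrC.
have w0 : nrm w != 0 by apply: contra_neq gw => /nrm_eq0 ->.
exists ((g w / nrm w ^+ 2)%:C *: w) => x; rewrite rdotZr.
have := mort ((- (g x / g w))%:C *: w + x).
rewrite lg mulNr divfK// addNr => /(_ erefl).
rewrite rdotDr rdotZr rdotxx mulNr rdotC => /eqP.
rewrite addrC subr_eq0 => /eqP ->.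
by field; rewrite gw.
Qed.

Definition symop A := forall x y, rdot (A x) y = rdot x (A y).

(** Riesz only gives the identity of real parts; using it also at ['i *: x] gives the imaginary
    parts, by complex linearity of T. *)
Lemma adjoint_exists T : bounded_op T ->
  exists S, bounded_op S /\ forall x y, dot (T x) y = dot x (S y).
Proof.
move=> /bounded_opP[lT [M M0 TM]].
have /choice[S TS] y : exists z, forall x, rdot (T x) y = rdot x z.
  apply: (@riesz _ (M * nrm y)) => [t u v|x].
    by rewrite lT rdotDl rdotZl.
  by rewrite (le_trans (rdot_abs_le _ _))// mulrAC ler_wpM2r ?nrm_ge0.
exists S; split; last first.
  by move=> x y; rewrite !dotE TS -linopZ// TS.
apply/bounded_opP; split.
  move=> a x y; apply: rdot_inj => z; rewrite -TS rdotDr [RHS]rdotDr -!TS; congr (_ + _).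
  by rewrite !rdotZCr -TS linopZ.
exists M => // y; have [->|d0] := eqVneq (nrm (S y)) 0; first by rewrite mulr_ge0 ?nrm_ge0.
have {}d0 : 0 < nrm (S y) by rewrite lt_def d0 nrm_ge0.
rewrite -(ler_pM2r d0) -expr2 -rdotxx -TS (le_trans (rdot_le _ _))//.
by rewrite mulrAC ler_wpM2r ?nrm_ge0.
Qed.

Lemma adjointP T : bounded_op T ->
  bounded_op (adjoint dot T) /\ forall x y, rdot (T x) y = rdot x (adjoint dot T y).
Proof.
move=> /adjoint_exists /(@getPex _ _) [bS TS]; split=> // x y.
by rewrite /rdot TS.
Qed.

(** Over the complex numbers, real values of the quadratic form force symmetry: expand the imaginary
    part of the form at i x + y. *)
Lemma positive_opP A :
  positive_op dot A <-> [/\ bounded_op A, symop A & forall x, 0 <= rdot (A x) x].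
Proof.
have iswap x y : rdot ('i *: x) y = - rdot x ('i *: y).
  by rewrite rdotZC; have -> : 'i^*%C = - 'i :> R[i]; [simpc|rewrite scaleNr rdotNr].
split=> [[bA Apos]|[bA sA Apos]]; last first.
  split=> // x; rewrite dotE; have -> : rdot ('i *: A x) x = 0.
    have : rdot ('i *: A x) x = - rdot ('i *: A x) x.
      by rewrite -[in LHS](linopZ (bounded_op_lin bA)) sA [LHS]iswap [in LHS]rdotC.
    by lra.
  by rewrite oppr0 ler0c.
have lA := bounded_op_lin bA.
have Aim x : rdot ('i *: A x) x = 0.
  by have := Apos x; rewrite dotE lecE /= oppr_eq0 => /andP[/eqP].
split=> // [x y|x]; last by have := Apos x; rewrite dotE lecE => /andP[].
have := Aim ('i *: x + y).
rewrite linopD// linopZ// scalerDr rdotDl !rdotDr Aim addr0 -linopZ// Aim add0r.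
rewrite linopZ// scalerA -expr2 sqr_i scaleN1r rdotNl [rdot ('i *: A y) _]iswap.
rewrite scalerA -expr2 sqr_i scaleN1r rdotNr opprK => /eqP.
by rewrite addrC subr_eq0 => /eqP <-; rewrite rdotC.
Qed.

End RealDot.

(** * Polynomials of an operator and the location of their singularities *)

Section OperatorPolynomial.
Context {R : realType} {H : completeNormedModType R[i]}.
Implicit Types (x y : H) (A : H -> H) (p q : {poly R}) (P Q : {poly R[i]}).

(** Complex coefficients allow a splitting into linear factors; [poly_op] is the case of real
    coefficients, by [poly_opE]. *)
Definition cpoly P A x := \sum_(i < size P) P`_i *: iter i A x.

Lemma cpolyE n P A x : (size P <= n)%N ->
  cpoly P A x = \sum_(i < n) P`_i *: iter i A x.
Proof.
move=> Pn; rewrite /cpoly (big_ord_widen n (fun i => P`_i *: iter i A x))// big_mkcond.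
apply: eq_bigr => i _; case: ltnP => // /(nth_default 0) ->.
by rewrite scale0r.
Qed.

Lemma cpolyD P Q A x : cpoly (P + Q) A x = cpoly P A x + cpoly Q A x.
Proof.
rewrite !(@cpolyE (maxn (size P) (size Q))) ?leq_maxl ?leq_maxr ?size_polyD//.
by rewrite -big_split; apply: eq_bigr => i _; rewrite coefD scalerDl.
Qed.

Lemma cpolyZ a P A x : cpoly (a *: P) A x = a *: cpoly P A x.
Proof.
rewrite !(@cpolyE (size P)) ?size_scale_leq// scaler_sumr.
by apply: eq_bigr => i _; rewrite coefZ scalerA.
Qed.

Lemma cpolyC a A x : cpoly a%:P A x = a *: x.
Proof. by rewrite (@cpolyE 1) ?size_polyC_leq1// big_ord1 coefC. Qed.

Lemma cpolyMX P A x : cpoly (P * 'X) A x = cpoly P A (A x).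
Proof.
rewrite (@cpolyE (size P).+1); last first.
  by rewrite (leq_trans (size_polyMleq _ _))// size_polyX addn2.
rewrite big_ord_recl coefMX scale0r add0r; apply: eq_bigr => i _.
by rewrite coefMX /= -iterSr.
Qed.

Lemma cpolyX A x : cpoly 'X A x = A x.
Proof. by rewrite -['X]mul1r cpolyMX -[1]/(1%:P) cpolyC scale1r. Qed.

Lemma linear_iter n A : linear A -> linear (iter n A).
Proof. by move=> lA; elim: n => [|n IH] a x y //; rewrite !iterS IH lA. Qed.

Lemma cpoly_linear P A : linear A -> linear (cpoly P A).
Proof.
move=> lA a x y; rewrite /cpoly scaler_sumr -big_split; apply: eq_bigr => i _ /=.
by rewrite (linear_iter _ lA) scalerDr !scalerA mulrC.
Qed.

Lemma cpolyM P Q A x : linear A -> cpoly (P * Q) A x = cpoly P A (cpoly Q A x).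
Proof.
move=> lA; elim/poly_ind: Q x => [|Q c IH] x.
  by rewrite mulr0 -[0]/(0%:P) !cpolyC !scale0r (linop0 (cpoly_linear _ lA)).
rewrite mulrDr mulrA [P * c%:P]mulrC mul_polyC !cpolyD !cpolyMX cpolyZ cpolyC IH.
by rewrite (linopD (cpoly_linear _ lA)) (linopZ (cpoly_linear _ lA)).
Qed.

Lemma bounded_op_iter n A : bounded_op A -> bounded_op (iter n A).
Proof.
move=> bA; elim: n => [|n IH]; first exact: bounded_op_id.
exact: bounded_op_comp bA IH.
Qed.

Lemma cpoly_bounded P A : bounded_op A -> bounded_op (cpoly P A).
Proof.
move=> bA; rewrite /cpoly; elim: (size P) => [|n IH].
  apply/bounded_opP; split; first by move=> a x y; rewrite !big_ord0 scaler0 addr0.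
  by exists 0 => // x; rewrite big_ord0 nrm0 mul0r.
have := bounded_opD P`_n IH (bounded_op_iter n bA).
by congr bounded_op; apply/funext => x; rewrite big_ord_recr.
Qed.

Lemma cpoly_inverse (r : seq R[i]) A : bounded_op A ->
  (forall z, z \in r -> exists S, inverse_ops (fun x => A x - z *: x) S) ->
  exists S, inverse_ops (cpoly (\prod_(z <- r) ('X - z%:P)) A) S.
Proof.
move=> bA; have lA := bounded_op_lin bA; elim: r => [|z r IH] rP.
  exists id; rewrite big_nil; have -> : cpoly 1 A = id.
    by apply/funext => x; rewrite -[1]/(1%:P) cpolyC scale1r.
  by split=> //; exact: bounded_op_id.
have [S zS] := rP z (mem_head _ _).
have [|S' rS] := IH; first by move=> w wr; apply: rP; rewrite in_cons wr orbT.
exists (S' \o S); have := inverse_ops_comp zS rS.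
congr (inverse_ops _ _); apply/funext => x /=.
by rewrite big_cons cpolyM// -polyCN cpolyD cpolyC cpolyX scaleNr.
Qed.

(** Half of the spectral mapping theorem: if no root of P were in the spectrum of A, every linear
    factor of P would be invertible at A, and so would their product. *)
Lemma cpoly_spectrum P A : bounded_op A -> P != 0 ->
  ~ (exists S, inverse_ops (cpoly P A) S) -> exists2 z, spectrum A z & root P z.
Proof.
move=> bA P0 nP; have [r Pr] := closed_field_poly_normal P.
apply: contra_notP nP => nz.
have c0 : lead_coef P != 0 by rewrite lead_coef_eq0.
have [|S rS] := @cpoly_inverse r A bA.
  move=> z zr; apply: contra_notP nz => nS; exists z => //.
  by rewrite Pr rootZ// root_prod_XsubC.
have := inverse_opsZ c0 rS => PS; eexists; move: PS.
by congr (inverse_ops _ _); apply/funext => x; rewrite [P in RHS]Pr cpolyZ.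
Qed.

Lemma poly_opE p A : poly_op p A = cpoly (map_poly (real_complex R) p) A.
Proof.
apply/funext => x; rewrite /poly_op /cpoly size_map_poly.
by apply: eq_bigr => i _; rewrite coef_map.
Qed.

Lemma poly_op_bounded p A : bounded_op A -> bounded_op (poly_op p A).
Proof. by rewrite poly_opE; exact: cpoly_bounded. Qed.

Lemma poly_opM p q A x : linear A -> poly_op (p * q) A x = poly_op p A (poly_op q A x).
Proof. by move=> lA; rewrite !poly_opE rmorphM /= cpolyM. Qed.

Lemma poly_opD p q A x : poly_op (p + q) A x = poly_op p A x + poly_op q A x.
Proof. by rewrite !poly_opE rmorphD /= cpolyD. Qed.

Lemma poly_opC (c : R) A x : poly_op c%:P A x = c%:C *: x.
Proof. by rewrite !poly_opE map_polyC cpolyC. Qed.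

Lemma poly_opX A x : poly_op 'X A x = A x.
Proof.
by rewrite poly_opE map_polyX cpolyX.
Qed.

Lemma poly_opB p q A x : poly_op (p - q) A x = poly_op p A x - poly_op q A x.
Proof.
rewrite poly_opD; congr (_ + _); rewrite -mulN1r !poly_opE rmorphM /= rmorphN rmorph1.
by rewrite -[-1]/((- 1)) -polyCN mul_polyC cpolyZ scaleN1r.
Qed.

End OperatorPolynomial.

(** * Spectrum of a symmetric operator and norms of its real polynomials *)

Section SymmetricSpectrum.
Context {R : realType} {H : completeNormedModType R[i]}.
Variable dot : {dot H for Num.conj}.
Hypothesis dot_norm : forall x : H, `|x| ^+ 2 = dot x x.
Implicit Types (x y : H) (A B : H -> H) (p q : {poly R}).

Local Notation rdot := (rdot dot).
Local Notation symop := (symop dot).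

Lemma poly_op_sym p A : symop A -> symop (poly_op p A).
Proof.
move=> sA x y; rewrite /poly_op rdot_suml [RHS]rdotC rdot_suml.
apply: eq_bigr => i _; rewrite !rdotZl [in RHS]rdotC; congr (_ * _).
by elim: {+}(i : nat) x y => //= n IH x y; rewrite sA IH -iterSr.
Qed.

Lemma symop_imag A x : bounded_op A -> symop A -> rdot ('i *: A x) x = 0.
Proof.
move=> bA sA.
have : rdot ('i *: A x) x = - rdot ('i *: A x) x.
  rewrite -[in LHS](linopZ (bounded_op_lin bA)) sA rdotZC.
  have -> : 'i^*%C = - 'i :> R[i] by simpc.
  by rewrite scaleNr rdotNr [in LHS]rdotC.
by lra.
Qed.

(** For z = u + i v with v <> 0, the operator i v (A - z) is coercive with constant v^2, because the
    real parts of the forms of i A and of i u vanish. *)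
Lemma symop_spectrum_real A (z : R[i]) : bounded_op A -> symop A -> spectrum A z ->
  z = (complex.Re z)%:C.
Proof.
move=> bA sA; case: z => u v sz; have [-> //|v0] := eqVneq v 0.
exfalso; apply: sz; pose a : R[i] := v%:C * 'i.
have a0 : a != 0 by rewrite mulf_neq0 ?(inj_eq (@complexI R))// neq0Ci.
have [|||S] := @coercive_inverse _ _ _ dot_norm
    (fun x => a *: (A x - (u +i* v) *: x)) (v ^+ 2).
- have bV := bounded_opB (u +i* v) bA.
  have := bounded_opD (a - 1) bV bV; congr bounded_op.
  by apply/funext => x; rewrite scalerBl scale1r addrC subrK.
- by rewrite lt_def sqrf_eq0 v0 sqr_ge0.
- move=> x; rewrite -scalerA rdotZl scalerBr rdotBl symop_imag// sub0r scalerA.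
  have -> : 'i * (u +i* v) = u%:C * 'i + (- v)%:C :> R[i] by simpc.
  rewrite scalerDl rdotDl -scalerA !rdotZl (symop_imag x (@bounded_op_id _ _))//.
  by rewrite mulr0 add0r mulNr opprK rdotxx// [leRHS]mulrA.
move=> /(@inverse_opsZ _ _ a^-1); rewrite invr_eq0 => /(_ a0) h; eexists; move: h.
by congr (inverse_ops _ _); apply/funext => x; rewrite scalerA mulVf// scale1r.
Qed.

(* If B^2 - N^2 had a bounded inverse, |B x| would be bounded by (N - d) |x| for
   some d > 0, since |(B^2 - N^2) x|^2 <= N^2 (N^2 |x|^2 - |B x|^2). *)
Lemma symop_norm_spectral B : (exists x : H, x != 0) -> bounded_op B -> symop B ->
  ~ exists S, inverse_ops (fun x => B (B x) - (opnorm B ^+ 2)%:C *: x) S.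
Proof.
move=> [x0 x0n] bB sB [S [_ bS TS ST]]; set N := opnorm B.
have N0 : 0 <= N by exact: opnorm_ge0.
have lB := bounded_op_lin bB.
have BN x : nrm (B x) <= N * nrm x by exact: opnorm_bd.
have [N00|Nn0] := eqVneq N 0.
  have B0 x : B x = 0.
    by apply: nrm_eq0; apply/le_anti; rewrite nrm_ge0 andbT -(mul0r (nrm x)) -N00.
  have := congr1 (@^~ x0) ST; rewrite /= B0 -/N N00 expr0n scale0r subr0.
  by rewrite (linop0 (bounded_op_lin bS)) => /esym/eqP; rewrite (negPf x0n).
pose C := opnorm S; have C0 : 0 <= C by exact: opnorm_ge0.
have SC x : nrm x <= C * nrm (B (B x) - (N ^+ 2)%:C *: x).
  by have := opnorm_bd bS (B (B x) - (N ^+ 2)%:C *: x); rewrite (congr1 (@^~ x) ST : S _ = x).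
(* With K, the estimate becomes N^2 |x|^2 <= K (N^2 |x|^2 - |B x|^2). Together with |B x| <= N |x|
   this gives (1 + K) |B x|^2 <= K N^2 |x|^2, hence the ratio k = K / (1 + K) < 1. *)
pose K := N ^+ 4 * C ^+ 2; have K0 : 0 <= K by rewrite mulr_ge0 ?exprn_ge0.
pose k := K / (1 + K); have K1 : 0 < 1 + K by rewrite ltr_wpDr.
have Bk x : nrm (B x) <= N * Num.sqrt k * nrm x.
  rewrite -(@ler_pXn2r _ 2)// ?nnegrE ?mulr_ge0 ?sqrtr_ge0 ?nrm_ge0//.
  rewrite !exprMn sqr_sqrtr ?divr_ge0 ?(ltW K1)//.
  have -> : N ^+ 2 * k * nrm x ^+ 2 = (N ^+ 2 * K * nrm x ^+ 2) / (1 + K) by rewrite /k; ring.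
  rewrite ler_pdivlMr//.
  have h1 : nrm x ^+ 2 <= C ^+ 2 * nrm (B (B x) - (N ^+ 2)%:C *: x) ^+ 2.
    by rewrite -exprMn ler_pXn2r ?nnegrE ?mulr_ge0 ?nrm_ge0.
  rewrite (nrm_sqB dot_norm) rdotZr sB rdotxx// nrmZ cabs_real ger0_norm ?exprn_ge0// in h1.
  have h2 : nrm (B (B x)) ^+ 2 <= N ^+ 2 * nrm (B x) ^+ 2.
    by rewrite -exprMn ler_pXn2r ?nnegrE ?mulr_ge0 ?nrm_ge0.
  have h3 : nrm (B x) ^+ 2 <= N ^+ 2 * nrm x ^+ 2.
    by rewrite -exprMn ler_pXn2r ?nnegrE ?mulr_ge0 ?nrm_ge0.
  have h4 : nrm x ^+ 2 <= C ^+ 2 * (N ^+ 2 * (N ^+ 2 * nrm x ^+ 2 - nrm (B x) ^+ 2)).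
    apply: le_trans h1 _; rewrite ler_wpM2l ?exprn_ge0// exprMn.
    move: h2; move: (nrm (B (B x)) ^+ 2) (nrm (B x) ^+ 2) (nrm x ^+ 2) => b3 b2 b1 h2.
    rewrite (_ : _ * (_ - _) = N ^+ 2 * b2 - 2 * (N ^+ 2 * b2) + (N ^+ 2) ^+ 2 * b1).
      by rewrite !lerD2r.
    by ring.
  have h5 : N ^+ 2 * nrm x ^+ 2 <= K * (N ^+ 2 * nrm x ^+ 2 - nrm (B x) ^+ 2).
    have -> : K * (N ^+ 2 * nrm x ^+ 2 - nrm (B x) ^+ 2) = N ^+ 2 *
      (C ^+ 2 * (N ^+ 2 * (N ^+ 2 * nrm x ^+ 2 - nrm (B x) ^+ 2))) by rewrite /K; ring.
    by rewrite ler_wpM2l ?exprn_ge0.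
  have := le_trans h3 h5.
  move: (nrm (B x) ^+ 2) (nrm x ^+ 2) => b2 b1.
  by rewrite mulrBr mulrDr mulr1; lra.
have k1 : Num.sqrt k < 1.
  by rewrite -sqrtr1 ltr_sqrt// ltr_pdivrMr// mul1r ltrDr.
have : N <= N * Num.sqrt k.
  by apply: opnorm_le => //; rewrite mulr_ge0 ?sqrtr_ge0.
by rewrite ler_pMr ?lt_def ?Nn0//= leNgt k1.
Qed.

(** With N = |p(A)|, the operator p(A)^2 - N^2 is not invertible, so p^2 - N^2 has a root t in the
    spectrum of A; t is real, and |p(t)| = N. *)
Lemma opnorm_poly_op p A (e : R) : bounded_op A -> symop A -> 0 <= e ->
  (forall t : R, spectrum A t%:C -> `|p.[t]| <= e) -> opnorm (poly_op p A) <= e.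
Proof.
move=> bA sA e0 pe; have lA := bounded_op_lin bA.
have bp q := poly_op_bounded q bA.
have [Hn0|H0] := pselect (exists x : H, x != 0); last first.
  apply: opnorm_le => //; first exact: bounded_op_lin.
  move=> x; have -> : x = 0.
    by apply/eqP/negPn/negP => x0; apply: H0; exists x.
  by rewrite (linop0 (bounded_op_lin (bp p))) nrm0 mulr0.
have rt q : q ^+ 2 - (opnorm (poly_op q A) ^+ 2)%:P != 0 -> exists t : R,
    spectrum A t%:C /\ q.[t] ^+ 2 = opnorm (poly_op q A) ^+ 2.
  set N := opnorm _ => Q0.
  have [|| z sz] := @cpoly_spectrum _ _ (map_poly (real_complex R) (q ^+ 2 - (N ^+ 2)%:P)) A bA.
  - by rewrite map_poly_eq0.
  - rewrite -poly_opE; have := symop_norm_spectral Hn0 (bp q) (poly_op_sym q sA).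
    apply: contra_not => -[S TS]; exists S; move: TS; congr (inverse_ops _ _).
    by apply/funext => x; rewrite poly_opB poly_opC expr2 poly_opM.
  have zr := symop_spectrum_real bA sA sz; move: sz; rewrite zr => sz.
  rewrite fmorph_root => /rootP; rewrite !hornerE => qz.
  by exists (complex.Re z); split => //; apply/eqP; rewrite -subr_eq0; apply/eqP.
suff [t [st pt]] : exists t : R, spectrum A t%:C /\ p.[t] ^+ 2 = opnorm (poly_op p A) ^+ 2.
  apply: le_trans (pe _ st); rewrite -(@ler_pXn2r _ 2)// ?nnegrE ?opnorm_ge0//.
  by rewrite real_normK ?num_real// pt.
(* If p^2 - N^2 is the zero polynomial, every t is a root, and what remains is to find some point in
   the spectrum; the same argument for ['X] supplies one, as 'X^2 minus a constant is never zero. *)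
have [p0|] := eqVneq (p ^+ 2 - (opnorm (poly_op p A) ^+ 2)%:P) 0; last exact: rt.
have [|t [st _]] := rt 'X.
  by rewrite -size_poly_eq0 size_polyDl size_polyXn// size_polyN (leq_ltn_trans (size_polyC_leq1 _)).
exists t; split => //; apply/eqP; rewrite -subr_eq0.
by have := congr1 (fun q => q.[t]) p0; rewrite !hornerE => ->.
Qed.

Lemma positive_spectrum_ge0 A (t : R) : bounded_op A -> (forall x, 0 <= rdot (A x) x) ->
  spectrum A t%:C -> 0 <= t <= opnorm A.
Proof.
move=> bA Apos st; apply/andP; split; last first.
  have := spectrum_bound bA (opnorm_ge0 bA) (opnorm_bd bA) st.
  by rewrite cabs_real; exact: le_trans (ler_norm _).
rewrite leNgt; apply/negP => t0; apply: st.
apply: (coercive_inverse dot_norm (c := - t)); first exact: bounded_opB.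
  by rewrite oppr_gt0.
by move=> x; rewrite rdotBl rdotZl rdotxx// mulNr lerDr.
Qed.

End SymmetricSpectrum.

(** * Uniform polynomial approximation of t^s on bounded intervals *)

Section PowerApproximation.
Context {R : realType}.
Implicit Types (g h : nat -> R) (a b c e s t x M : R).

(** On [0, 1] one has z <= z^s; apply this to x / (x + y) and y / (x + y), which sum to 1, and scale
    back. *)
Lemma powR_subadd s x y : 0 <= s <= 1 -> 0 <= x -> 0 <= y ->
  (x + y) `^ s <= x `^ s + y `^ s.
Proof.
move=> /andP[s0 s1] x0 y0; have [xy0|xyn0] := eqVneq (x + y) 0.
  have -> : x = 0 by apply/le_anti; rewrite x0 andbT -xy0 lerDl.
  by rewrite add0r lerDr powR_ge0.
have w0 : 0 < x + y by rewrite lt_def xyn0 addr_ge0.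
have fle (z : R) : 0 <= z -> z <= x + y -> z / (x + y) <= (z / (x + y)) `^ s.
  move=> z0 zw; have [->|zn0] := eqVneq z 0; first by rewrite mul0r powR_ge0.
  have {}z0 : 0 < z by rewrite lt_def zn0.
  by rewrite ger1_powR// divr_gt0//= ler_pdivrMr ?mul1r.
have xf : x / (x + y) <= (x / (x + y)) `^ s by apply: fle; rewrite ?lerDl.
have yf : y / (x + y) <= (y / (x + y)) `^ s by apply: fle; rewrite ?lerDr.
have scale (z : R) : 0 <= z -> (z / (x + y)) `^ s * (x + y) `^ s = z `^ s.
  by move=> z0; rewrite -powRM ?divr_ge0 ?(ltW w0)// divfK.
rewrite -(scale x)// -(scale y)// -mulrDl ler_peMl ?powR_ge0//.
by rewrite (le_trans _ (lerD xf yf))// -mulrDl divff.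
Qed.

Lemma powR_holder s x y : 0 <= s <= 1 -> 0 <= x -> 0 <= y ->
  `|x `^ s - y `^ s| <= `|x - y| `^ s.
Proof.
move=> s01; wlog yx : x y / y <= x => [hw|] x0 y0.
  have [/hw|/ltW /hw] := leP y x; first exact.
  by rewrite distrC [`|x - y|]distrC; apply.
have s0 : 0 <= s by case/andP: s01.
rewrite !ger0_norm ?subr_ge0// ?ge0_ler_powR// ?nnegrE//.
rewrite lerBlDl (le_trans _ (powR_subadd s01 _ _)) ?subr_ge0//.
by rewrite addrC subrK.
Qed.

(* Bernstein's polynomials with nodes 0, ..., n, built by the recursion that
   conditions a binomial law on its first trial. *)
Fixpoint bernstein n g : {poly R} :=
  if n is m.+1 then 'X * bernstein m (g \o succn) + (1 - 'X) * bernstein m g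
  else (g 0%N)%:P.

Lemma bernstein_le n g h x : 0 <= x <= 1 -> (forall k, g k <= h k) ->
  (bernstein n g).[x] <= (bernstein n h).[x].
Proof.
move=> /andP[x0 x1]; elim: n g h => [|n IH] g h gh; rewrite /= !hornerE//.
by rewrite lerD// ler_wpM2l ?subr_ge0//; apply: IH => k //=.
Qed.

(** The second moment of a binomial law about c: squared bias plus variance n x (1 - x). A free c
    lets the induction run, since the shift of the nodes replaces c by c - 1. *)
Lemma bernstein_quadratic n a b c x :
  (bernstein n (fun k => a + b * (k%:R - c) ^+ 2)).[x] =
  a + b * ((n%:R * x - c) ^+ 2 + n%:R * x * (1 - x)).
Proof.
elim: n c => [|n IH] c; first by rewrite /= !hornerE; ring.
rewrite /= !hornerE IH.
have -> : (fun k => a + b * (k%:R - c) ^+ 2) \o succn =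
    (fun k => a + b * (k%:R - (c - 1)) ^+ 2).
  by apply/funext => k /=; rewrite -natr1; ring.
by rewrite IH -natr1; ring.
Qed.

(** Bernstein's operator is monotone and explicit on quadratics, so it suffices to squeeze k |-> (k
    / n)^s between two quadratics in k centred at n t. *)
Lemma powR_approx01 s e : 0 <= s <= 1 -> 0 < e ->
  exists p : {poly R}, forall t, 0 <= t <= 1 -> `|p.[t] - t `^ s| <= e.
Proof.
move=> s01 e0; have [->|sn0] := eqVneq s 0.
  (* Here 0^0 = 1 matters: the function is constant on the whole interval, 0 included. *)
  by exists 1 => t _; rewrite powRr0 !hornerE subrr normr0 ltW.
have s0 : 0 < s by rewrite lt_def sn0; case/andP: s01.
(* The cap at 1 ensures d <= 1, whence |x - y| <= r = |x - y| / d; beyond the distance d this gives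
   |x - y|^s <= r^s <= r <= r^2, while d^s = e' covers the rest. *)
pose e' := Num.min 1 (e / 2).
have e'0 : 0 < e' by rewrite lt_min ltr01 divr_gt0.
have e'1 : e' <= 1 by rewrite ge_min lexx.
pose d := e' `^ s^-1; have d0 : 0 < d by rewrite powR_gt0.
have ds : d `^ s = e' by rewrite -powRrM mulVf// powRr1 ?ltW.
have d1 : d <= 1.
  suff : d <= 1 `^ s^-1 by rewrite powR1.
  by rewrite ge0_ler_powR ?nnegrE ?invr_ge0 ?(ltW s0) ?(ltW e'0).
have modulus x y : 0 <= x -> 0 <= y -> `|x `^ s - y `^ s| <= e' + (x - y) ^+ 2 / d ^+ 2.
  move=> x0 y0; rewrite (le_trans (powR_holder s01 x0 y0))//.
  have [xyd|/ltW dxy] := leP `|x - y| d.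
    rewrite (@le_trans _ _ e') ?lerDl ?divr_ge0 ?sqr_ge0//.
    by rewrite -[leRHS]ds ge0_ler_powR ?nnegrE ?(ltW s0) ?(ltW d0).
  rewrite (@le_trans _ _ ((x - y) ^+ 2 / d ^+ 2)) ?lerDr ?(ltW e'0)//.
  rewrite -[(x - y) ^+ 2]real_normK ?num_real// -expr_div_n.
  set r := `|x - y| / d; have r1 : 1 <= r by rewrite ler_pdivlMr ?mul1r.
  rewrite (@le_trans _ _ (r `^ s))//.
    rewrite ge0_ler_powR ?nnegrE ?(ltW s0)// ?(le_trans ler01)//.
    by rewrite ler_pdivlMr// ler_piMr.
  rewrite (@le_trans _ _ r)//; first by apply: ler1_powR => //; case/andP: s01.
  by rewrite expr2 ler_peMl// (le_trans ler01).
(* The variance contributes at most 1 / (d^2 (n + 1)), since t (1 - t) <= 1. *)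
have [n nP] : exists n : nat, (d ^+ 2)^-1 / n.+1%:R <= e / 2.
  have [n nP] : exists n : nat, (d ^+ 2)^-1 / (e / 2) <= n%:R.
    exists (Num.truncn ((d ^+ 2)^-1 / (e / 2))).+1.
    by rewrite ltW// truncnS_gt.
  exists n; rewrite ler_pdivrMr ?ltr0n// mulrC -ler_pdivrMr ?divr_gt0//.
  by rewrite (le_trans nP)// ler_nat.
pose g k : R := (k%:R / n.+1%:R) `^ s.
exists (bernstein n.+1 g) => t /[dup] t01 /andP[t0 t1].
have N0 : n.+1%:R != 0 :> R by rewrite pnatr_eq0.
pose b := (d ^+ 2)^-1 / n.+1%:R ^+ 2.
have gt k : `|g k - t `^ s| <= e' + b * (k%:R - n.+1%:R * t) ^+ 2.
  rewrite (le_trans (modulus _ _ _ t0))// ?divr_ge0// le_eqVlt; apply/orP; left.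
  apply/eqP; rewrite /b; move: (n.+1%:R : R) N0 => N N0.
  by field; rewrite N0 gt_eqF.
have bnd : b * (n.+1%:R * t * (1 - t)) <= e / 2.
  apply: le_trans nP; have -> : b * (n.+1%:R * t * (1 - t)) =
      (d ^+ 2)^-1 / n.+1%:R * (t * (1 - t)).
    rewrite /b; move: (n.+1%:R : R) N0 => N N0.
    by field; rewrite N0 gt_eqF.
  by rewrite ler_piMr ?divr_ge0 ?invr_ge0 ?sqr_ge0// mulr_ile1 ?subr_ge0// gerBl.
have e'e : e' <= e / 2 by rewrite ge_min lexx orbT.
rewrite ler_distl; apply/andP; split.
  have /(bernstein_le n.+1 t01) : forall k,
      (t `^ s - e') + - b * (k%:R - n.+1%:R * t) ^+ 2 <= g k.
    by move=> k; have := gt k; rewrite ler_distl mulNr => /andP[+ _]; lra.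
  by rewrite bernstein_quadratic subrr expr0n add0r mulNr; lra.
have /(bernstein_le n.+1 t01) : forall k,
    g k <= (t `^ s + e') + b * (k%:R - n.+1%:R * t) ^+ 2.
  by move=> k; have := gt k; rewrite ler_distl => /andP[_]; lra.
by rewrite bernstein_quadratic subrr expr0n add0r; lra.
Qed.

Lemma powR_approx s M e : 0 <= s <= 1 -> 0 < e ->
  exists p : {poly R}, forall t, 0 <= t <= M -> `|p.[t] - t `^ s| <= e.
Proof.
move=> s01 e0; pose N := `|M| + 1; have N0 : 0 < N by rewrite ltr_wpDl.
have Ns0 : 0 < N `^ s by rewrite powR_gt0.
have [p pP] := powR_approx01 s01 (divr_gt0 e0 Ns0).
exists (N `^ s *: (p \Po (N^-1 *: 'X))) => t /andP[t0 tM].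
have tN : 0 <= t / N <= 1.
  rewrite divr_ge0 ?(ltW N0)//= ler_pdivrMr// mul1r (le_trans tM)//.
  by rewrite (le_trans (ler_norm _))// lerDl.
have -> : t `^ s = N `^ s * (t / N) `^ s.
  by rewrite -powRM ?(ltW N0) ?divr_ge0 ?(ltW N0)// mulrCA divff ?mulr1 ?gt_eqF.
rewrite !hornerE horner_comp !hornerE -mulrBr normrM gtr0_norm// mulrC.
by rewrite -ler_pdivlMr// [N^-1 * t]mulrC pP.
Qed.

End PowerApproximation.

(** * Functional calculus and fractional powers of positive operators *)

Section PositivePowers.
Context {R : realType} {H : completeNormedModType R[i]}.
Variable dot : {dot H for Num.conj}.
Hypothesis dot_norm : forall x : H, `|x| ^+ 2 = dot x x.
Implicit Types (x y : H) (T A B C D : H -> H) (p q : {poly R}) (f g h : R -> R).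

Local Notation rdot := (rdot dot).
Local Notation symop := (symop dot).
Local Notation positive_op := (positive_op dot).

Lemma eps_nrm_le x y (K : R) : (forall e : R, 0 < e -> nrm x <= nrm y + K * e) ->
  nrm x <= nrm y.
Proof.
move=> xy; apply/ler_addgt0Pr => e e0.
have K0 : 0 < `|K| + 1 by rewrite ltr_wpDl.
rewrite (le_trans (xy _ (divr_gt0 e0 K0)))// lerD2l mulrA ler_pdivrMr//.
by rewrite [leRHS]mulrC ler_wpM2r ?(ltW e0)// (le_trans (ler_norm _))// lerDl.
Qed.

(** Completeness of the bounded operators, with an explicit rate: being uniform in x, it survives
    the passage to pointwise limits and makes the limit linear and bounded. *)
Lemma operator_limit (S : nat -> H -> H) : (forall n, bounded_op (S n)) ->
  (forall n k x, nrm (S n x - S k x) <= (n.+1%:R^-1 + k.+1%:R^-1) * nrm x) ->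
  exists B, bounded_op B /\ forall n x, nrm (S n x - B x) <= n.+1%:R^-1 * nrm x.
Proof.
move=> bS dS; have lS n := bounded_op_lin (bS n).
have /choice[B BP] x : exists l, forall n, nrm (S n x - l) <= n.+1%:R^-1 * nrm x.
  have [|l lP] := @cauchy_limit _ _ (fun n => S n x).
    move=> e e0; have p0 : 0 < nrm x + 1 by rewrite ltr_wpDl ?nrm_ge0.
    have [|N NP] := @inv_succ_small _ (e / 2 / (nrm x + 1)); first by rewrite !divr_gt0.
    exists N => n Nn; rewrite (le_trans (dS _ _ _))//.
    have hN k : (N <= k)%N -> k.+1%:R^-1 * nrm x <= e / 2.
      move=> /NP; rewrite ler_pdivlMr// => /le_trans -/(_ _) h.
      rewrite (@le_trans _ _ (k.+1%:R^-1 * (nrm x + 1)))//; last exact: h.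
      by rewrite ler_wpM2l ?invr_ge0// lerDl.
    by rewrite mulrDl [e]splitr lerD ?hN.
  exists l => n; apply/ler_addgt0Pr => e e0.
  have [|N1 N1P] := lP (e / 2); first by rewrite divr_gt0.
  have p0 : 0 < nrm x + 1 by rewrite ltr_wpDl ?nrm_ge0.
  have [|N2 N2P] := @inv_succ_small _ (e / 2 / (nrm x + 1)); first by rewrite !divr_gt0.
  pose N := maxn N1 N2.
  rewrite (le_trans (nrm_dist (S N x) _ _))// (le_trans (lerD (dS _ _ _) (N1P N _))) ?leq_maxl//.
  rewrite mulrDl -addrA lerD2l [leRHS]splitr lerD2r.
  have := N2P N (leq_maxr _ _); rewrite ler_pdivlMr//; apply: le_trans.
  by rewrite ler_wpM2l ?invr_ge0// lerDl.
exists B; split; last by move=> n x; exact: BP.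
apply/bounded_opP; split; last first.
  have [_ [M M0 SM]] := (bounded_opP _).1 (bS 0%N).
  exists (M + 1); first by rewrite addr_ge0.
  move=> x; have -> : B x = S 0%N x - (S 0%N x - B x) by rewrite opprB addrC subrK.
  rewrite (le_trans (nrmB _ _))// mulrDl lerD//.
  by rewrite (le_trans (BP _ _))// invr1.
move=> a x y; apply: subr0_eq; apply: nrm_eps0 => e e0.
pose K := nrm (a *: x + y) + cabs a * nrm x + nrm y + 1.
have K0 : 0 < K by rewrite ltr_wpDl// !addr_ge0 ?mulr_ge0 ?nrm_ge0 ?cabs_ge0.
have [|N NP] := @inv_succ_small _ (e / K); first by rewrite divr_gt0.
have := NP N (leqnn _); rewrite ler_pdivlMr//; apply: le_trans.
have -> : B (a *: x + y) - (a *: B x + B y) =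
    - (S N (a *: x + y) - B (a *: x + y)) + (a *: (S N x - B x) + (S N y - B y)).
  by rewrite lS scalerBr [in RHS]addrACA -opprD opprB [in RHS]addrA subrK.
rewrite (le_trans (nrmD _ _))// nrmN (le_trans (lerD (BP _ _) (nrmD _ _)))//.
rewrite nrmZ (le_trans (lerD (lexx _) (lerD (ler_wpM2l (cabs_ge0 a) (BP _ _)) (BP _ _))))//.
rewrite mulrCA -!mulrDr ler_wpM2l ?invr_ge0// /K !addrA lerDl//.
Qed.

(** The property by which [cfc] picks its value. The lemmas below hold for every B that has it, so
    they apply to [op_pow] as soon as [op_powP] shows that one exists. *)
Definition calculus A f B := bounded_op B /\ forall e : R, 0 < e ->
  exists2 p, forall t : R, spectrum A t%:C -> `|p.[t] - f t| <= e &
             opnorm (fun x => poly_op p A x - B x) <= e.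

Lemma poly_op_subr p A B : bounded_op A -> bounded_op B ->
  bounded_op (fun x => poly_op p A x - B x).
Proof.
move=> bA bB; have := bounded_opD (-1) (poly_op_bounded p bA) bB.
by congr bounded_op; apply/funext => x; rewrite scaleN1r.
Qed.

Lemma calculus_approx A f B (e : R) : bounded_op A -> calculus A f B -> 0 < e ->
  exists2 p, forall t : R, spectrum A t%:C -> `|p.[t] - f t| <= e &
             opbd e (fun x => poly_op p A x - B x).
Proof.
move=> bA [bB AB] e0; have [p pf pB] := AB e e0; exists p => // x.
rewrite (le_trans (opnorm_bd (poly_op_subr p bA bB) _))//.
by rewrite ler_wpM2r ?nrm_ge0.
Qed.

Lemma calculus_poly p A : bounded_op A -> calculus A (horner p) (poly_op p A).
Proof.
move=> bA; split; first exact: poly_op_bounded.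
move=> e e0; exists p => [t _|]; first by rewrite subrr normr0 ltW.
have bp := poly_op_bounded p bA.
apply: opnorm_le; rewrite ?(ltW e0)//; first exact: bounded_op_lin (poly_op_subr _ _ _).
by move=> x; rewrite subrr nrm0 mulr_ge0 ?nrm_ge0 ?ltW.
Qed.

Lemma calculus_sym A f B : bounded_op A -> symop A -> calculus A f B -> symop B.
Proof.
move=> bA sA AB x y; apply/eqP; rewrite -subr_eq0 -normr_eq0 eq_le normr_ge0 andbT.
apply/ler_addgt0Pr => e e0; rewrite add0r.
pose K := nrm x * nrm y + 1.
have K0 : 0 < K by rewrite ltr_wpDl// mulr_ge0 ?nrm_ge0.
have [|p _ pB] := @calculus_approx A f B (e / 2 / K) bA AB; first by rewrite !divr_gt0.
have -> : rdot (B x) y - rdot x (B y) =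
    rdot x (poly_op p A y - B y) - rdot (poly_op p A x - B x) y.
  by rewrite rdotBl rdotBr (poly_op_sym p sA); ring.
have h1 : nrm x * nrm y * (e / 2 / K) <= e / 2.
  by rewrite mulrA ler_pdivrMr// mulrC ler_wpM2l ?divr_ge0 ?(ltW e0)// lerDl.
rewrite (le_trans (ler_normB _ _))// [leRHS]splitr lerD// (le_trans _ h1)//.
  rewrite (le_trans (rdot_abs_le dot_norm _ _))// -mulrA ler_wpM2l ?nrm_ge0//.
  by rewrite mulrC pB.
apply: le_trans (rdot_abs_le dot_norm _ _) _.
apply: le_trans (ler_wpM2r (nrm_ge0 y) (pB x)) _.
by rewrite [leRHS]mulrC mulrA.
Qed.

Lemma calculus_norm A f B (M : R) : bounded_op A -> symop A -> calculus A f B ->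
  0 <= M -> (forall t : R, spectrum A t%:C -> `|f t| <= M) -> opbd M B.
Proof.
move=> bA sA AB M0 fM x; have := @eps_nrm_le (B x) (M%:C *: x) (2 * nrm x).
rewrite nrmZ cabs_real ger0_norm//; apply => e e0.
have [p pf pB] := calculus_approx bA AB e0.
have -> : B x = poly_op p A x - (poly_op p A x - B x) by rewrite opprB addrC subrK.
have pM : opnorm (poly_op p A) <= M + e.
  apply: (opnorm_poly_op dot_norm) => //; first by rewrite addr_ge0 ?(ltW e0).
  move=> t st; have -> : p.[t] = f t + (p.[t] - f t) by rewrite addrC subrK.
  by rewrite (le_trans (ler_normD _ _))// lerD ?fM ?pf.
have := opnorm_bd (poly_op_bounded p bA) x.
have := ler_wpM2r (nrm_ge0 x) pM; have := pB x; have := nrmB (poly_op p A x) (poly_op p A x - B x).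
by lra.
Qed.

(** If p, q, r approximate f, g, h = f g on the spectrum, then p q - r is small there, hence p(A)
    q(A) is close to r(A) in norm. As D is arbitrary, this also expresses uniqueness of the
    calculus. *)
Lemma calculus_mul A f g h B C D (Mf Mg : R) : bounded_op A -> symop A ->
  0 <= Mf -> 0 <= Mg ->
  (forall t : R, spectrum A t%:C -> [/\ `|f t| <= Mf, `|g t| <= Mg & h t = f t * g t]) ->
  calculus A f B -> calculus A g C -> calculus A h D -> B \o C = D.
Proof.
move=> bA sA Mf0 Mg0 fgh AB AC AD; apply/funext => x /=.
apply: subr0_eq; apply: nrm_eq0; apply/le_anti; rewrite nrm_ge0 andbT.
have [bB _] := AB; have [bC _] := AC; have [bD _] := AD.
have CN := calculus_norm bA sA AC Mg0 (fun t st => let: And3 _ h _ := fgh t st in h).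
(* One summand for each of the four errors [h1] to [h4] below; e <= 1 is what bounds |p| by Mf + 1
   on the spectrum. *)
pose K := Mg * nrm x + (Mf + 1) * nrm x + (Mf + 1 + Mg + 1) * nrm x + nrm x.
suff Ke (e : R) : 0 < e -> e <= 1 -> nrm (B (C x) - D x) <= K * e.
  have := @eps_nrm_le (B (C x) - D x) 0 K; rewrite nrm0; apply => e e0; rewrite add0r.
  have m0 : 0 < Num.min e 1 by rewrite lt_min e0 ltr01.
  have m1 : Num.min e 1 <= 1 by rewrite ge_min lexx orbT.
  rewrite (le_trans (Ke _ m0 m1))// ler_wpM2l ?ge_min ?lexx//.
  by rewrite /K !addr_ge0 ?mulr_ge0 ?addr_ge0 ?nrm_ge0.
move=> e0 e1.
have [p pf pB] := calculus_approx bA AB e0.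
have [q qg qC] := calculus_approx bA AC e0.
have [r rh rD] := calculus_approx bA AD e0.
have bp s := poly_op_bounded s bA; have lp s := bounded_op_lin (bp s).
have pM t : spectrum A t%:C -> `|p.[t]| <= Mf + 1.
  move=> st; have -> : p.[t] = f t + (p.[t] - f t) by rewrite addrC subrK.
  have [ft _ _] := fgh t st.
  by rewrite (le_trans (ler_normD _ _))// lerD// (le_trans (pf _ st)).
have pN : opnorm (poly_op p A) <= Mf + 1.
  by apply: (opnorm_poly_op dot_norm) => //; rewrite addr_ge0.
have pqrN : opnorm (poly_op (p * q - r) A) <= (Mf + 1 + Mg + 1) * e.
  apply: (opnorm_poly_op dot_norm) => //; first by rewrite mulr_ge0 ?(ltW e0)// !addr_ge0.
  move=> t st; have [ft gt ht] := fgh t st; rewrite !hornerE.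
  have -> : p.[t] * q.[t] - r.[t] =
      p.[t] * (q.[t] - g t) + (p.[t] - f t) * g t - (r.[t] - h t) by rewrite ht; ring.
  have k1 : `|p.[t] * (q.[t] - g t)| <= (Mf + 1) * e.
    by rewrite normrM ler_pM ?pM ?qg.
  have k2 : `|(p.[t] - f t) * g t| <= Mg * e.
    by rewrite normrM mulrC ler_pM ?pf.
  have := ler_normB (p.[t] * (q.[t] - g t) + (p.[t] - f t) * g t) (r.[t] - h t).
  have := ler_normD (p.[t] * (q.[t] - g t)) ((p.[t] - f t) * g t).
  have := rh _ st; lra.
have -> : B (C x) - D x = - (poly_op p A (C x) - B (C x)) -
    poly_op p A (poly_op q A x - C x) + poly_op (p * q - r) A x + (poly_op r A x - D x).
  rewrite poly_opB poly_opM; last exact: bounded_op_lin.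
  by rewrite (linopB (lp p)) !opprB !addrA !subrK.
have h1 : nrm (poly_op p A (C x) - B (C x)) <= Mg * nrm x * e.
  by rewrite (le_trans (pB _))// mulrC ler_wpM2r ?(ltW e0).
have h2 : nrm (poly_op p A (poly_op q A x - C x)) <= (Mf + 1) * nrm x * e.
  rewrite (le_trans (opnorm_bd (bp p) _))// -mulrA ler_pM ?opnorm_ge0 ?nrm_ge0//.
  by rewrite mulrC.
have h3 : nrm (poly_op (p * q - r) A x) <= (Mf + 1 + Mg + 1) * nrm x * e.
  by rewrite (le_trans (opnorm_bd (bp _) _))// mulrAC ler_wpM2r ?nrm_ge0.
have h4 := rD x; rewrite mulrC in h4.
rewrite /K.
have := nrmD (- (poly_op p A (C x) - B (C x)) -
    poly_op p A (poly_op q A x - C x) + poly_op (p * q - r) A x) (poly_op r A x - D x).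
have := nrmD (- (poly_op p A (C x) - B (C x)) -
    poly_op p A (poly_op q A x - C x)) (poly_op (p * q - r) A x).
have := nrmB (- (poly_op p A (C x) - B (C x))) (poly_op p A (poly_op q A x - C x)).
rewrite nrmN; lra.
Qed.

Lemma positive_spectrum A (t : R) : positive_op A -> spectrum A t%:C -> 0 <= t <= opnorm A.
Proof. by move=> /positive_opP[bA _ A0]; exact: (positive_spectrum_ge0 dot_norm). Qed.

(** The spectrum lies in [0, |A|], so polynomials converging uniformly to t^s there are Cauchy at A
    by [opnorm_poly_op]; their limit is the witness that [get] requires. *)
Lemma op_powP A (s : R) : positive_op A -> 0 <= s <= 1 ->
  calculus A (fun t => t `^ s) (op_pow A s).
Proof.
move=> pA s01; have [bA sA A0] := (positive_opP _ _).1 pA; apply: getPex.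
have n0 n : 0 < n.+1%:R^-1 :> R by rewrite invr_gt0.
have /choice[p pP] n := powR_approx (opnorm A) s01 (n0 n).
have bp q := poly_op_bounded q bA.
have [||B [bB BP]] := @operator_limit (fun n => poly_op (p n) A).
- by move=> n.
- move=> n k x; rewrite -poly_opB (le_trans (opnorm_bd (bp _) _))//.
  rewrite ler_wpM2r ?nrm_ge0//; apply: (opnorm_poly_op dot_norm) => //.
  move=> t /(positive_spectrum pA) tA; rewrite !hornerE.
  have -> : (p n).[t] - (p k).[t] = ((p n).[t] - t `^ s) - ((p k).[t] - t `^ s) by ring.
  by rewrite (le_trans (ler_normB _ _))// lerD ?pP.
exists B; split => // e e0.
have [N /(_ N (leqnn _)) Ne] := inv_succ_small e0.
exists (p N) => [t /(positive_spectrum pA) tA|]; first by rewrite (le_trans (pP _ _ _)).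
apply: opnorm_le; rewrite ?(ltW e0)//; first exact: bounded_op_lin (poly_op_subr _ _ _).
by move=> x; rewrite (le_trans (BP _ _))// ler_wpM2r ?nrm_ge0.
Qed.

Lemma op_pow_bounded A (s : R) : positive_op A -> 0 <= s <= 1 -> bounded_op (op_pow A s).
Proof. by move=> pA /(op_powP pA) []. Qed.

Lemma spectrum_powR A (s t : R) : positive_op A -> 0 <= s -> spectrum A t%:C ->
  `|t `^ s| <= opnorm A `^ s.
Proof.
move=> pA s0 /(positive_spectrum pA)/andP[t0 tA].
by rewrite ger0_norm ?powR_ge0// ge0_ler_powR// ?nnegrE// (le_trans t0).
Qed.

Lemma op_pow_norm A (s : R) : positive_op A -> 0 <= s <= 1 ->
  opbd (opnorm A `^ s) (op_pow A s).
Proof.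
move=> pA /[dup] s01 /andP[s0 _]; have [bA sA _] := (positive_opP _ _).1 pA.
apply: (calculus_norm bA sA (op_powP pA s01)) => [|t st]; first exact: powR_ge0.
exact: spectrum_powR.
Qed.

Lemma op_powD A (s r : R) : positive_op A -> 0 <= s -> 0 <= r -> s + r <= 1 ->
  op_pow A s \o op_pow A r = op_pow A (s + r).
Proof.
move=> pA s0 r0 sr1; have [bA sA _] := (positive_opP _ _).1 pA.
have s01 : 0 <= s <= 1 by rewrite s0 (le_trans _ sr1)// lerDl.
have r01 : 0 <= r <= 1 by rewrite r0 (le_trans _ sr1)// lerDr.
have sr01 : 0 <= s + r <= 1 by rewrite sr1 addr_ge0.
apply: (calculus_mul bA sA _ _ _ (op_powP pA s01) (op_powP pA r01) (op_powP pA sr01));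
  [exact: (powR_ge0 (opnorm A) s)|exact: (powR_ge0 (opnorm A) r)|move=> t st].
split; [exact: spectrum_powR|exact: spectrum_powR|].
(* The law of exponents at base 0 needs s + r <> 0; otherwise both exponents vanish and all three
   powers are 1. *)
have [sr0|sr0] := eqVneq (s + r) 0; last by rewrite powRD// (negPf sr0).
have -> : s = 0 by lra.
have -> : r = 0 by lra.
by rewrite addr0 powRr0 mulr1.
Qed.

Lemma op_pow1 A : positive_op A -> op_pow A 1 = A.
Proof.
move=> pA; have [bA sA _] := (positive_opP _ _).1 pA.
have A1 : calculus A (fun t => t `^ 1) (op_pow A 1) by apply: op_powP => //; rewrite ler01 lexx.
have AX := calculus_poly 'X bA.
have A0 := calculus_poly 1 bA.
have X : poly_op 'X A = A by apply/funext => x; rewrite poly_opX.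
have id1 : poly_op 1 A = id.
  by apply/funext => x; rewrite -[1]/(1%:P) poly_opC scale1r.
rewrite X in AX; rewrite id1 in A0.
(* Uniqueness in the form of a product: t^1 times the constant 1 is the polynomial t on the
   spectrum, where t >= 0. *)
apply: (calculus_mul bA sA (powR_ge0 (opnorm A) 1) ler01 _ A1 A0 AX) => t st.
split; first exact: spectrum_powR.
  by rewrite hornerE normr1.
by rewrite !hornerE powRr1//; case/andP: (positive_spectrum pA st).
Qed.

Lemma positive_sqrt A : positive_op A -> exists B, positive_op B /\ B \o B = A.
Proof.
move=> pA; have [bA sA _] := (positive_opP _ _).1 pA.
have s01 : 0 <= (2^-1 : R) <= 1 by lra.
have s04 : 0 <= (4^-1 : R) <= 1 by lra.
exists (op_pow A 2^-1); split; last first.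
  rewrite op_powD; [|exact: pA|lra..].
  have -> : 2^-1 + 2^-1 = 1 :> R by lra.
  exact: op_pow1.
apply/positive_opP; split.
- exact: op_pow_bounded.
- exact: calculus_sym bA sA (op_powP pA s01).
(* Positivity of the square root comes from writing it as the square of the symmetric operator
   A^(1/4). *)
- move=> x; have -> : op_pow A 2^-1 = op_pow A 4^-1 \o op_pow A 4^-1.
    by rewrite op_powD; [congr (op_pow A); lra|exact: pA|lra..].
  by rewrite /= (calculus_sym bA sA (op_powP pA s04)) rdot_ge0.
Qed.

End PositivePowers.

(** * Modulus, polar decomposition and Aluthge transform *)

Section PolarDecomposition.
Context {R : realType} {H : completeNormedModType R[i]}.
Variable dot : {dot H for Num.conj}.
Hypothesis dot_norm : forall x : H, `|x| ^+ 2 = dot x x.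
Implicit Types (x y v k : H) (T A U S V : H -> H).

Local Notation rdot := (rdot dot).
Local Notation symop := (symop dot).
Local Notation positive_op := (positive_op dot).

Lemma adjoint_comp_positive T : bounded_op T -> positive_op (adjoint dot T \o T).
Proof.
move=> bT; have [bS TS] := adjointP dot_norm bT.
apply/positive_opP; split; first exact: bounded_op_comp.
- by move=> x y /=; rewrite rdotC -TS rdotC -TS.
- by move=> x /=; rewrite rdotC -TS rdot_ge0.
Qed.

Lemma abs_opP T : bounded_op T ->
  positive_op (abs_op dot T) /\ abs_op dot T \o abs_op dot T = adjoint dot T \o T.
Proof.
move=> /adjoint_comp_positive /(positive_sqrt dot_norm) ex.
exact: getPex ex.
Qed.

Lemma nrm_abs_op T x : bounded_op T -> nrm (abs_op dot T x) = nrm (T x).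
Proof.
move=> bT; have [/positive_opP[_ sA _] AA] := abs_opP bT.
have [_ TS] := adjointP dot_norm bT.
apply/eqP; rewrite -(@eqrXn2 _ 2)// ?nrm_ge0// -!(rdotxx dot_norm) -sA.
have AAx : abs_op dot T (abs_op dot T x) = adjoint dot T (T x) := congr1 (@^~ x) AA.
by rewrite AAx rdotC -TS.
Qed.

Lemma opnorm_abs_op T : bounded_op T -> opnorm (abs_op dot T) = opnorm T.
Proof.
move=> bT; have [/positive_opP[bA _ _] _] := abs_opP bT.
apply/le_anti/andP; split; apply: opnorm_le; rewrite ?opnorm_ge0//.
- exact: bounded_op_lin.
- by move=> x; rewrite nrm_abs_op//; exact: opnorm_bd.
- exact: bounded_op_lin.
- by move=> x; rewrite -nrm_abs_op//; exact: opnorm_bd.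
Qed.

Section PolarRelation.
Variable T : H -> H.
Hypothesis bT : bounded_op T.
Let A := abs_op dot T.
Let lT : linear T. Proof. exact: bounded_op_lin. Qed.
Let bA : bounded_op A. Proof. by have [/positive_opP[]] := abs_opP bT. Qed.
Let lA : linear A. Proof. exact: bounded_op_lin. Qed.
Let sA : symop A. Proof. by have [/positive_opP[]] := abs_opP bT. Qed.
Let nA x : nrm (A x) = nrm (T x). Proof. exact: nrm_abs_op. Qed.

(* The closure of the graph of k + |T| y |-> T y, where k ranges over ker T. *)
Let polar_rel x v := forall e : R, 0 < e -> exists y k,
  [/\ T k = 0, nrm (x - (k + A y)) <= e & nrm (v - T y) <= e].

Let ker_orth k y : T k = 0 -> rdot k (A y) = 0.
Proof.
by move=> Tk; rewrite -sA; have -> : A k = 0; rewrite ?rdot0l//; apply: nrm_eq0; rewrite nA Tk nrm0.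
Qed.

(** The vectors k and |T| y are orthogonal and |T| y has the norm of T y. By linearity this
    contraction property also makes the relation single-valued. *)
Let polar_rel_le x v : polar_rel x v -> nrm v <= nrm x.
Proof.
move=> xv; apply/ler_addgt0Pr => e e0.
have [|y [k [Tk xe ve]]] := xv (e / 2); first by rewrite divr_gt0.
have h1 : nrm (A y) <= nrm (k + A y).
  rewrite -(@ler_pXn2r _ 2)// ?nnegrE ?nrm_ge0// (nrm_sqD dot_norm) ker_orth//.
  by rewrite mulr0 addr0 lerDr sqr_ge0.
have := nrmD (v - T y) (T y); rewrite subrK -nA.
have := nrmD (k + A y - x) x; rewrite subrK nrmBC; lra.
Qed.

Let polar_rel_lin (a : R[i]) x x' v v' :
  polar_rel x v -> polar_rel x' v' -> polar_rel (a *: x + x') (a *: v + v').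
Proof.
move=> xv xv' e e0.
have a0 : 0 < cabs a + 1 by rewrite ltr_wpDl ?cabs_ge0.
have [|y [k [Tk xe ve]]] := xv (e / (cabs a + 1)); first by rewrite divr_gt0.
have [|y' [k' [Tk' xe' ve']]] := xv' (e / (cabs a + 1)); first by rewrite divr_gt0.
have small u u' : nrm u <= e / (cabs a + 1) -> nrm u' <= e / (cabs a + 1) ->
    nrm (a *: u + u') <= e.
  move=> ue ue'; rewrite (le_trans (nrmD _ _))// nrmZ.
  have -> : e = cabs a * (e / (cabs a + 1)) + e / (cabs a + 1).
    by field; rewrite gt_eqF.
  by rewrite lerD// ler_wpM2l ?cabs_ge0.
exists (a *: y + y'), (a *: k + k'); split.
- by rewrite lT Tk Tk' scaler0 addr0.
- have -> : a *: x + x' - (a *: k + k' + A (a *: y + y')) =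
      a *: (x - (k + A y)) + (x' - (k' + A y')); last exact: small.
  by rewrite lA addrACA -scalerDr opprD addrACA -scalerBr.
- have -> : a *: v + v' - T (a *: y + y') = a *: (v - T y) + (v' - T y').
    by rewrite lT opprD addrACA -scalerBr.
  exact: small.
Qed.

(** Project x to m on the closure of the range of |T|. The remainder x - m is in ker T, and |T| y_n
    -> m makes T y_n Cauchy because both sequences have equal distances. *)
Let polar_rel_total x : exists v, polar_rel x v.
Proof.
have [||m [mcl mort]] := @projection _ _ _ dot_norm (fun z => exists y, z = A y) x.
- by exists 0; rewrite linop0.
- by move=> t _ _ [y ->] [z ->]; exists (t%:C *: y + z); rewrite lA.
have n0 n : 0 < n.+1%:R^-1 :> R by rewrite invr_gt0.
have /choice[u uP] n : exists y, nrm (m - A y) <= n.+1%:R^-1.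
  by have [_ [y ->] my] := mcl _ (n0 n); exists y.
have [|v vP] := @cauchy_limit _ _ (fun n => T (u n)).
  move=> e e0; have [|N NP] := @inv_succ_small _ (e / 2); first by rewrite divr_gt0.
  exists N => n Nn; rewrite -linopB// -nA linopB//.
  rewrite (le_trans (nrm_dist m _ _))// [leRHS]splitr lerD//.
    by rewrite nrmBC (le_trans (uP _))// NP.
  by rewrite (le_trans (uP _))// NP.
have Txm : T (x - m) = 0.
  apply: nrm_eq0; rewrite -nA; apply/eqP; rewrite -sqrf_eq0 -(rdotxx dot_norm) sA.
  by apply/eqP/mort; exists (A (x - m)).
exists v => e e0; have [N1 N1P] := inv_succ_small e0; have [N2 N2P] := vP _ e0.
exists (u (maxn N1 N2)), (x - m); split => //.
  rewrite opprD addrA opprB addrCA subrr addr0.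
  by rewrite (le_trans (uP _))// N1P// leq_maxl.
by rewrite nrmBC N2P// leq_maxr.
Qed.

Lemma polar_exists : exists U, [/\ partial_isometry dot U, T = U \o abs_op dot T &
  forall x, U x = 0 <-> T x = 0].
Proof.
have /choice[U UP] := polar_rel_total; exists U.
have uniq x v w : polar_rel x v -> polar_rel x w -> v = w.
  move=> xv xw; apply: subr0_eq; apply: nrm_eq0; apply/le_anti; rewrite nrm_ge0 andbT.
  have := polar_rel_le (polar_rel_lin (-1) xw xv).
  by rewrite !scaleN1r addNr nrm0 addrC.
have lU : linear U.
  by move=> a x y; apply: uniq (UP _) _; exact: polar_rel_lin.
have kerU x : U x = 0 <-> T x = 0.
  split=> [Ux|Tx]; last first.
    apply: uniq (UP _) _ => e e0; exists 0, x; split => //.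
      by rewrite (linop0 lA) addr0 subrr nrm0 ltW.
    by rewrite (linop0 lT) subrr nrm0 ltW.
  have [M M0 AM] := ((bounded_opP _).1 bA).2.
  (* Both parts of |T| x, the error and |T| (|T| y), have norm at most M e'; the added 1 keeps the
     denominator positive when M = 0. *)
  apply: nrm_eps0 => e e0; pose e' := e / (2 * M + 1).
  have p0 : 0 < 2 * M + 1 by rewrite ltr_wpDl// mulr_ge0.
  have [|y [k [Tk xe]]] := UP x e'; first by rewrite divr_gt0.
  rewrite Ux sub0r nrmN => Ty; rewrite -nA.
  have -> : A x = A (x - (k + A y)) + A (A y).
    rewrite (linopB lA) (linopD lA); have -> : A k = 0 by apply: nrm_eq0; rewrite nA Tk nrm0.
    by rewrite add0r subrK.
  rewrite (le_trans (nrmD _ _))//.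
  have h1 := le_trans (AM (x - (k + A y))) (ler_wpM2l M0 xe).
  rewrite -nA in Ty; have h2 := le_trans (AM (A y)) (ler_wpM2l M0 Ty).
  have -> : e = 2 * M * e' + e' by rewrite /e'; field; rewrite gt_eqF.
  have : 0 <= e' by rewrite divr_ge0 ?ltW.
  by lra.
split => //; last first.
  apply/funext => y /=; apply: uniq (UP _) => e e0; exists y, 0; split.
  - exact: linop0.
  - by rewrite add0r subrr nrm0 ltW.
  - by rewrite subrr nrm0 ltW.
split; first by apply/bounded_opP; split => //; exists 1 => // x; rewrite mul1r polar_rel_le.
move=> x xker; suff : nrm (U x) = nrm x by rewrite !nrmE => ->.
apply/le_anti; rewrite polar_rel_le//=; apply/ler_addgt0Pr => e e0.
have [|y [k [Tk xe ve]]] := UP x (e / 3); first by rewrite divr_gt0.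
have kx : rdot x k = 0 by rewrite /rdot xker//; exact/kerU.
(* As x and |T| y are orthogonal to k, |k|^2 is the product of k with the approximation error k +
   |T| y - x. *)
have ke : nrm k <= e / 3.
  have [->|k0] := eqVneq (nrm k) 0; first by rewrite divr_ge0 ?ltW.
  have {}k0 : 0 < nrm k by rewrite lt_def k0 nrm_ge0.
  rewrite -(ler_pM2r k0) -expr2 -(rdotxx dot_norm).
  have -> : rdot k k = rdot (k + A y - x) k.
    by rewrite rdotBl rdotDl kx subr0 [rdot (A y) k]rdotC ker_orth// addr0.
  by rewrite (le_trans (rdot_le dot_norm _ _))// ler_wpM2r ?nrm_ge0// nrmBC.
have := nrmD (x - (k + A y)) (k + A y); rewrite subrK.
have := nrmD k (A y); rewrite nA.
have := nrmD (T y - U x) (U x); rewrite subrK nrmBC; lra.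
Qed.

End PolarRelation.

Lemma polar_isometryP T : bounded_op T ->
  partial_isometry dot (polar_isometry dot T) /\ T = polar_isometry dot T \o abs_op dot T.
Proof. by move=> /polar_exists /(@getPex _ _) []. Qed.

(** Split x along the closed kernel of U: only the orthogonal part counts, and there U is
    isometric. *)
Lemma partial_isometry_le U x : partial_isometry dot U -> nrm (U x) <= nrm x.
Proof.
move=> [bU isoU]; have lU := bounded_op_lin bU.
have [||m [mcl mort]] := @projection _ _ _ dot_norm (fun z => U z = 0) x.
- exact: linop0.
- by move=> t y z Uy Uz; rewrite lU Uy Uz scaler0 addr0.
have Um : U m = 0.
  have [M M0 UM] := ((bounded_opP _).1 bU).2.
  apply: nrm_eps0 => e e0; have p0 : 0 < M + 1 by rewrite ltr_wpDl.
  have [|d Ud md] := mcl (e / (M + 1)); first by rewrite divr_gt0.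
  have -> : U m = U (m - d) by rewrite linopB// Ud subr0.
  rewrite (le_trans (UM _))//; move: md; rewrite ler_pdivlMr// mulrC; apply: le_trans.
  by rewrite ler_wpM2r ?nrm_ge0// lerDl.
have -> : U x = U (x - m) by rewrite linopB// Um subr0.
have -> : nrm (U (x - m)) = nrm (x - m).
  (* Real orthogonality to the kernel implies complex orthogonality, the kernel being stable under
     multiplication by i. *)
  rewrite /nrm isoU// => y Uy; rewrite dotE mort// rdotZC mort ?oppr0//.
  by rewrite linopZ// Uy scaler0.
have {2}-> : x = (x - m) + m by rewrite subrK.
rewrite -(@ler_pXn2r _ 2)// ?nnegrE ?nrm_ge0// [leRHS](nrm_sqD dot_norm) mort//.
by rewrite mulr0 addr0 lerDl sqr_ge0.
Qed.

(** Jacobson's identity: if W inverts V S - z, then z^-1 (S W V - 1) inverts S V - z. *)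
Lemma spectrum_comm S V (z : R[i]) : bounded_op S -> bounded_op V -> z != 0 ->
  spectrum (S \o V) z -> spectrum (V \o S) z.
Proof.
move=> bS bV z0; apply: contra_not => -[W [_ bW VW WV]].
have lS := bounded_op_lin bS; have lV := bounded_op_lin bV; have lW := bounded_op_lin bW.
have VWx x : V (S (W x)) = x + z *: W x.
  by have := congr1 (@^~ x) VW; rewrite /= => /eqP; rewrite subr_eq => /eqP.
have WVx x : W (V (S x)) = x + z *: W x.
  have := congr1 (@^~ x) WV; rewrite /= (linopB lW) (linopZ lW) => /eqP.
  by rewrite subr_eq => /eqP.
exists (fun x => z^-1 *: (S (W (V x)) - x)); split.
- by apply: bounded_opB; exact: bounded_op_comp.
- have b1 := bounded_op_comp bS (bounded_op_comp bW bV).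
  have b2 := bounded_opD (-1) b1 (@bounded_op_id _ H).
  have := bounded_opD (z^-1 - 1) b2 b2; congr bounded_op.
  by apply/funext => x; rewrite scalerBl scale1r addrC subrK scaleN1r.
- apply/funext => x /=; rewrite (linopZ lV) (linopZ lS).
  have -> : S (V (S (W (V x)) - x)) = z *: S (W (V x)).
    by rewrite (linopB lV) VWx addrAC subrr add0r (linopZ lS).
  by rewrite !scalerA mulVf// mulfV// !scale1r opprB addrC subrK.
- apply/funext => x /=; rewrite (linopB lV) (linopZ lV) (linopB lW) (linopZ lW) WVx.
  rewrite addrK opprB addrCA subrr addr0 scalerA mulVf// scale1r.
  by [].
Qed.

(** * Norm and nonzero spectrum of a single transform *)

Section Aluthge.
Variables (lambda : R) (T : H -> H).
Hypotheses (lambda01 : 0 <= lambda <= 1) (bT : bounded_op T).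
Let A := abs_op dot T.
Let pA : positive_op A. Proof. by have [] := abs_opP bT. Qed.
Let l01 : 0 <= 1 - lambda <= 1.
Proof. by move: lambda01; lra. Qed.
Let B := op_pow A lambda.
Let C := op_pow A (1 - lambda).
Let U := polar_isometry dot T.
Let bB : bounded_op B. Proof. exact: (op_pow_bounded dot_norm). Qed.
Let bC : bounded_op C. Proof. exact: (op_pow_bounded dot_norm). Qed.
Let bU : bounded_op U. Proof. by have [[]] := polar_isometryP bT. Qed.

Lemma aluthge_bounded : bounded_op (aluthge dot lambda T).
Proof. exact: bounded_op_comp (bounded_op_comp bB bU) bC. Qed.

Lemma opnorm_aluthge : opnorm (aluthge dot lambda T) <= opnorm T.
Proof.
apply: opnorm_le; rewrite ?opnorm_ge0//.
  exact: bounded_op_lin aluthge_bounded.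
have -> : opnorm T = opnorm A `^ lambda * opnorm A `^ (1 - lambda).
  (* The exponents lambda and 1 - lambda sum to 1, so the law holds also when the norm is 0. *)
  rewrite -powRD; last by rewrite addrCA subrr addr0 oner_eq0.
  rewrite addrCA subrr addr0 powRr1 ?opnorm_abs_op// opnorm_ge0//.
move=> x; have [isoU _] := polar_isometryP bT.
rewrite -mulrA (le_trans (op_pow_norm dot_norm pA lambda01 _))//.
rewrite ler_wpM2l ?powR_ge0//= (le_trans (partial_isometry_le _ isoU))//.
exact: (op_pow_norm dot_norm).
Qed.

Lemma spectrum_aluthge (z : R[i]) : z != 0 ->
  spectrum T z -> spectrum (aluthge dot lambda T) z.
Proof.
move=> z0 sT; apply: (spectrum_comm (bounded_op_comp bU bC) bB z0).
suff <- : T = (U \o C) \o B by [].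
have [_ {1}->] := polar_isometryP bT; rewrite -compA; congr (_ \o _).
rewrite (op_powD dot_norm) ?subrK ?(op_pow1 dot_norm)//.
- by case/andP: l01.
- by case/andP: lambda01.
Qed.

End Aluthge.
End PolarDecomposition.

(** * Decay of powers beyond the spectral radius *)

Section SpectralRadius.
Context {R : realType} {H : completeNormedModType R[i]}.
Variable T : H -> H.
Hypothesis bT : bounded_op T.
Implicit Types (x y : H) (w z : R[i]) (m n : nat).
Let lT : linear T. Proof. exact: bounded_op_lin. Qed.

Lemma cabsD w z : cabs (w + z) <= cabs w + cabs z.
Proof. by rewrite -lecR rmorphD /= -!cabsE ler_normD. Qed.

Lemma cabs_le_parts (a b : R) : cabs (a +i* b) <= `|a| + `|b|.
Proof.
have -> : a +i* b = a%:C + 'i * b%:C by simpc.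
rewrite (le_trans (cabsD _ _))// cabsM !cabs_real.
have -> : cabs ('i : R[i]) = 1 by rewrite /cabs normc_def /= expr0n add0r expr1n sqrtr1.
by rewrite mul1r.
Qed.

(** A bound at w0 persists, doubled, on a neighbourhood of w0, and compactness turns the local
    bounds into one. The disc is handled inside a square of real coordinates. *)
Lemma resolvent_bound (s0 : R) :
  (forall w, cabs w <= s0 -> exists S, inverse_ops (fun x => x - w *: T x) S) ->
  exists2 M, 0 < M & forall w, cabs w <= s0 -> forall x, nrm x <= M * nrm (x - w *: T x).
Proof.
move=> inv; have [K K0 TK] := ((bounded_opP T).1 bT).2.
pose P (M : R) (c : R * R) := cabs (c.1 +i* c.2) <= s0 ->
  forall x, nrm x <= M * nrm (x - (c.1 +i* c.2) *: T x).
have cK : compact (`[- s0, s0] `*` `[- s0, s0] : set (R * R))%classic.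
  by apply: compact_setX; exact: segment_compact.
have : (\forall M \near +oo, (`[- s0, s0] `*` `[- s0, s0] : set (R * R)) `<=` P M)%classic.
  apply: ((compact_near_coveringP _).1 cK) => -[a0 b0] _ /=.
  pose w0 := a0 +i* b0.
  have dist (d a b : R) : ball (a0, b0) d (a, b) -> cabs ((a +i* b) - w0) <= 2 * d.
    move=> [/=]; rewrite -!ball_normE /= => ad bd.
    have -> : (a +i* b) - w0 = (a - a0) +i* (b - b0) by rewrite /w0; simpc.
    rewrite (le_trans (cabs_le_parts _ _))// [`|a - _|]distrC [`|b - _|]distrC.
    by move: ad bd; lra.
  have [w0s|w0s] := leP (cabs w0) s0; last first.
    (* Outside the disc the neighbourhood is chosen to miss the disc, so that [P] holds vacuously:
       points of the ball move by at most 2 d, half the gap. *)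
    pose d := (cabs w0 - s0) / 4; have d0 : 0 < d by rewrite divr_gt0// subr_gt0.
    exists (ball (a0, b0) d, setT)%classic.
      by split; [exact: nbhsx_ballx|exact: filterT].
    move=> [[a b] M] /= [/dist dab _]; rewrite /P /= => ws0.
    have := cabsD (w0 - (a +i* b)) (a +i* b); rewrite subrK -[cabs (w0 - _)]cabsN opprB => h.
    by exfalso; move: h dab w0s ws0; rewrite /d; lra.
  have [S [_ bS _ SV]] := inv _ w0s.
  have [M0 M00 SM] := ((bounded_opP S).1 bS).2.
  have xM x : nrm x <= M0 * nrm (x - w0 *: T x).
    by have := SM (x - w0 *: T x); rewrite (congr1 (@^~ x) SV : S _ = x).
  (* Small enough for the perturbation, of size at most 2 d M0 K |x|, to be absorbed as |x| / 2 in
     the left-hand side. *)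
  pose d := (4 * (M0 * K + 1))^-1.
  have MK0 : 0 <= M0 * K by rewrite mulr_ge0.
  have d0 : 0 < d by rewrite invr_gt0 mulr_gt0// ltr_wpDl.
  exists (ball (a0, b0) d, [set M : R | 2 * M0 <= M])%classic.
    by split; [exact: nbhsx_ballx|apply: nbhs_pinfty_ge; rewrite num_real].
  move=> [[a b] M] /= [/dist dab M0M]; rewrite /P /= => _ x.
  rewrite (@le_trans _ _ (2 * M0 * nrm (x - (a +i* b) *: T x)))//; last first.
    by rewrite ler_wpM2r ?nrm_ge0.
  set w := a +i* b in dab *.
  have h1 : nrm (x - w0 *: T x) <= nrm (x - w *: T x) + 2 * d * (K * nrm x).
    have -> : x - w0 *: T x = (x - w *: T x) + (w - w0) *: T x.
      by rewrite scalerBl addrA subrK.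
    rewrite (le_trans (nrmD _ _))// lerD2l nrmZ.
    by rewrite ler_pM ?cabs_ge0 ?nrm_ge0.
  have h2 : M0 * (2 * d * (K * nrm x)) <= nrm x / 2.
    have -> : M0 * (2 * d * (K * nrm x)) = (M0 * K / (M0 * K + 1)) * (nrm x / 2).
      by rewrite /d; field; rewrite gt_eqF// ltr_wpDl.
    by rewrite ler_piMl ?divr_ge0 ?nrm_ge0// ler_pdivrMr ?mul1r ?lerDl// ltr_wpDl.
  have := xM x; have := ler_wpM2l M00 h1; rewrite mulrDr.
  by move: h2; lra.
move=> Mnear.
have [M [MP M0]] : exists M, (`[- s0, s0] `*` `[- s0, s0] `<=` P M)%classic /\ 0 < M.
  have : (\forall M \near +oo, 0 < M :> R)%classic by apply: nbhs_pinfty_gt; rewrite num_real.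
  by move=> /(filterI Mnear) /filter_ex [M [? ?]]; exists M.
exists M => // -[a b] ws0; apply: (MP (a, b)) => //=.
have ab : `|a| <= s0 /\ `|b| <= s0.
  have h : cabs (a +i* b) ^+ 2 = a ^+ 2 + b ^+ 2.
    by rewrite /cabs normc_def /= sqr_sqrtr// addr_ge0 ?sqr_ge0.
  have hc := cabs_ge0 (a +i* b).
  split; apply: le_trans ws0; rewrite -(@ler_pXn2r _ 2)// ?nnegrE//.
    by rewrite real_normK ?num_real// h lerDl sqr_ge0.
  by rewrite real_normK ?num_real// h lerDr sqr_ge0.
by split; rewrite /= in_itv /= -ler_norml; case: ab.
Qed.

Definition dyadic_power m w x := w ^+ (2 ^ m)%N *: iter (2 ^ m)%N T x.

Lemma dyadic_power_linear m w : linear (dyadic_power m w).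
Proof.
move=> a x y; rewrite /dyadic_power (linear_iter _ lT) scalerDr !scalerA.
by rewrite [a * _]mulrC.
Qed.

Lemma dyadic_powerS m w x :
  dyadic_power m.+1 w x = dyadic_power m w (dyadic_power m w x).
Proof.
rewrite /dyadic_power (linopZ (linear_iter _ lT)) scalerA -exprD -iterD.
by rewrite addnn -mul2n -expnS.
Qed.

Lemma dyadic_root m : exists2 u : R[i], cabs u = 1 & u ^+ (2 ^ m)%N = - 1.
Proof.
have [u um] : exists u : R[i], u ^+ (2 ^ m)%N = - 1.
  elim: m => [|m [u um]]; first by exists (- 1); rewrite expr1.
  by exists (sqrtC u); rewrite expnS exprM sqrtCK.
exists u => //; have /eqP := congr1 cabs um.
by rewrite cabsX cabsN cabs1 pexpr_eq1 ?cabs_ge0 ?expn_gt0// => /eqP.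
Qed.

(* (1 - V^2)^-1 = ((1 - V)^-1 + (1 + V)^-1) / 2, where 1 + (w T)^(2^m) is
   1 - (u w T)^(2^m) for any u with u^(2^m) = -1: the Lipschitz constant of the
   resolvent is inherited by all the functions (1 - (w T)^(2^m))^-1. *)
Lemma dyadic_resolvent (s0 D : R) m :
  (exists G : R[i] -> H -> H,
    (forall w, cabs w <= s0 -> forall x, G w (x - w *: T x) = x /\ G w x - w *: T (G w x) = x) /\
    (forall w z, cabs w <= s0 -> cabs z <= s0 -> forall x,
        nrm (G w x - G z x) <= D * cabs (w - z) * nrm x)) ->
  exists G : R[i] -> H -> H,
    (forall w, cabs w <= s0 -> forall x,
       G w (x - dyadic_power m w x) = x /\ G w x - dyadic_power m w (G w x) = x) /\
    (forall w z, cabs w <= s0 -> cabs z <= s0 -> forall x,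
        nrm (G w x - G z x) <= D * cabs (w - z) * nrm x).
Proof.
move=> base; elim: m => [//|m [G [Ginv Glip]]].
have [u u1 um] := dyadic_root m.
have rot w : cabs (u * w) = cabs w by rewrite cabsM u1 mul1r.
have powu w x : dyadic_power m (u * w) x = - dyadic_power m w x.
  by rewrite /dyadic_power exprMn um mulN1r scaleNr.
have half x : (2^-1)%:C *: (x + x) = x.
  by rewrite -mulr2n -[x *+ 2]scaler_nat scalerA fmorphV rmorphMn rmorph1 mulVf ?pnatr_eq0// scale1r.
exists (fun w x => (2^-1)%:C *: (G w x + G (u * w) x)); split.
  move=> w ws0 x; have us0 : cabs (u * w) <= s0 by rewrite rot.
  set V := dyadic_power m w; have lV : linear V by exact: dyadic_power_linear.
  have GV y : G w (y - V y) = y by case: (Ginv _ ws0 y).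
  have VG y : G w y - V (G w y) = y by case: (Ginv _ ws0 y).
  have GV' y : G (u * w) (y + V y) = y.
    by have [] := Ginv _ us0 y; rewrite powu opprK.
  have VG' y : G (u * w) y + V (G (u * w) y) = y.
    by have [_] := Ginv _ us0 y; rewrite powu opprK.
  rewrite !dyadic_powerS -/V; clearbody V; split.
    have -> : x - V (V x) = (x + V x) - V (x + V x).
      by rewrite (linopD lV) opprD addrA addrK.
    rewrite GV; have -> : (x + V x) - V (x + V x) = (x - V x) + V (x - V x).
      by rewrite (linopD lV) (linopB lV) opprD !addrA addrK subrK.
    by rewrite GV' addrACA subrr addr0 half.
  rewrite !(linopZ lV) -scalerBr !(linopD lV) opprD addrACA.
  set y := G w x; set y' := G (u * w) x.
  have -> : y - V (V y) = x + V x.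
    by rewrite -[in RHS](VG x) -/y (linopB lV) addrA subrK.
  have -> : y' - V (V y') = x - V x.
    by rewrite -[in RHS](VG' x) -/y' (linopD lV) opprD addrA addrK.
  by rewrite addrACA subrr addr0 half.
move=> w z ws0 zs0 x; rewrite -scalerBr opprD addrACA nrmZ cabs_real.
rewrite ger0_norm ?invr_ge0// mulrC ler_pdivrMr//.
have h1 := Glip _ _ ws0 zs0 x.
have := Glip (u * w) (u * z); rewrite !rot -mulrBr rot => /(_ ws0 zs0 x).
have := nrmD (G w x - G z x) (G (u * w) x - G (u * z) x); lra.
Qed.

(* Rickart's proof of the spectral radius formula: smallness of the powers of
   s T propagates from s = 0 to s = 1/rho in steps of uniform length. *)
Lemma power_decay (rho : R) : 0 < rho ->
  (forall z, rho <= cabs z -> ~ spectrum T z) ->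
  exists2 n, (0 < n)%N & forall x, nrm (iter n T x) <= rho ^+ n * nrm x.
Proof.
move=> rho0 srho; pose s0 := rho^-1; have s00 : 0 < s0 by rewrite invr_gt0.
have inv w : cabs w <= s0 -> exists S, inverse_ops (fun x => x - w *: T x) S.
  move=> ws0; have [->|w0] := eqVneq w 0.
    exists id; have -> : (fun x => x - 0 *: T x) = id.
      by apply/funext => x; rewrite scale0r subr0.
    by split=> //; exact: bounded_op_id.
  have : rho <= cabs w^-1 by rewrite cabsV -[rho]invrK lef_pV2 ?posrE// cabs_gt0.
  move=> /srho /contrapT [S] /(@inverse_opsZ _ _ (- w)); rewrite oppr_eq0 => /(_ w0) h; eexists; move: h.
  congr (inverse_ops _ _); apply/funext => x.
  by rewrite scaleNr scalerBr opprB scalerA divff// scale1r.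
have [K K0 TK] := ((bounded_opP T).1 bT).2.
have [M M0 MP] := resolvent_bound inv.
have /choice[F FP] w : exists S, cabs w <= s0 -> inverse_ops (fun x => x - w *: T x) S.
  have [/inv[S]|] := leP (cabs w) s0; first by exists S.
  by exists id.
(* From the resolvent identity F w - F z = (w - z) F w T F z, with M bounding both resolvents and K
   bounding T. *)
pose D := M * K * M.
have base : exists G : R[i] -> H -> H,
    (forall w, cabs w <= s0 -> forall x, G w (x - w *: T x) = x /\ G w x - w *: T (G w x) = x) /\
    (forall w z, cabs w <= s0 -> cabs z <= s0 -> forall x,
        nrm (G w x - G z x) <= D * cabs (w - z) * nrm x).
  exists F; split.
    move=> w /FP[_ _ TF FT] x.
    by split; [exact: (congr1 (@^~ x) FT)|exact: (congr1 (@^~ x) TF)].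
  move=> w z ws0 zs0 x; rewrite (le_trans (MP _ ws0 _))//.
  have Fw : F w x - w *: T (F w x) = x by have [_ _ TF _] := FP _ ws0; exact: (congr1 (@^~ x) TF).
  have Fz : F z x - z *: T (F z x) = x by have [_ _ TF _] := FP _ zs0; exact: (congr1 (@^~ x) TF).
  have -> : F w x - F z x - w *: T (F w x - F z x) = (w - z) *: T (F z x).
    rewrite linopB// scalerBr opprD addrACA Fw opprK -{1}Fz addrACA subrr add0r.
    by rewrite addrC -scalerBl.
  rewrite nrmZ /D -!mulrA ler_wpM2l ?(ltW M0)//.
  have Fx : nrm (F z x) <= M * nrm x by rewrite -{2}Fz MP.
  rewrite [leRHS](_ : _ = cabs (w - z) * (K * (M * nrm x))); last by ring.
  by rewrite ler_wpM2l ?cabs_ge0// (le_trans (TK _))// ler_wpM2l.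
have D0 : 0 <= D by rewrite !mulr_ge0 ?(ltW M0).
pose P (s : R) := exists m, forall x, nrm (dyadic_power m s%:C x) <= 2^-1 * nrm x.
have Psmall s : P s -> exists m, forall x, nrm (dyadic_power m s%:C x) <= 16^-1 * nrm x.
  (* Two squarings turn the factor 1/2 into (1/2)^4 = 1/16. *)
  move=> [m mP]; exists m.+2 => x; rewrite !dyadic_powerS.
  have h1 := mP x.
  have h2 := mP (dyadic_power m s%:C x).
  have h3 := mP (dyadic_power m s%:C (dyadic_power m s%:C x)).
  have h4 := mP (dyadic_power m s%:C (dyadic_power m s%:C (dyadic_power m s%:C x))).
  by lra.
(* For y = x - V x, x is the resolvent of y at s. The resolvent at s' is within |y| / 16 of x, and
   close to y because the power at s' is small; so V x = x - y is small. The step length depends on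
   D only, not on m. *)
have step (s s' : R) : 0 <= s <= s0 -> 0 <= s' <= s0 -> D * `|s - s'| <= 16^-1 -> P s' -> P s.
  move=> /andP[s_ge0 ss0] /andP[s'_ge0 s's0] ss' /Psmall[m mP].
  have [G [Ginv Glip]] := dyadic_resolvent m base.
  have cs : cabs (s%:C) <= s0 by rewrite cabs_real ger0_norm.
  have cs' : cabs (s'%:C) <= s0 by rewrite cabs_real ger0_norm.
  exists m => x; set V := dyadic_power m s%:C.
  pose y := x - V x; have Gy : G s%:C y = x by case: (Ginv _ cs x).
  have [_ Gy'] := Ginv _ cs' y.
  have h1 : nrm (G s'%:C y - y) <= 16^-1 * nrm (G s'%:C y).
    rewrite -{2}Gy' opprB addrCA subrr addr0; exact: mP.
  have h2 : nrm (x - G s'%:C y) <= 16^-1 * nrm y.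
    rewrite -{1}Gy (le_trans (Glip _ _ cs cs' y))// ler_wpM2r ?nrm_ge0//.
    by rewrite -rmorphB cabs_real.
  have h3 : nrm (V x) <= nrm (x - G s'%:C y) + nrm (G s'%:C y - y).
    have -> : V x = x - y by rewrite /y opprB addrC subrK.
    exact: nrm_dist.
  have h4 := nrmD (G s'%:C y - y) y; rewrite subrK in h4.
  have h5 : nrm y <= nrm x + nrm (V x) by exact: nrmB.
  by have := nrm_ge0 x; have := nrm_ge0 y; lra.
have [N NP] : exists N : nat, 16 * D * s0 <= N.+1%:R.
  exists (Num.truncn (16 * D * s0)); by rewrite ltW// truncnS_gt.
have N0 : 0 < N.+1%:R :> R by rewrite ltr0n.
have PN k : (k <= N.+1)%N -> P (s0 * (k%:R / N.+1%:R)).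
  elim: k => [_|k IH kN].
    (* At s = 0 the exponent 2^0 = 1 already gives the zero operator. *)
    exists 0%N => x; rewrite mul0r mulr0 /dyadic_power expr1 scale0r nrm0.
    by rewrite mulr_ge0 ?nrm_ge0.
  have bd j : (j <= N.+1)%N -> 0 <= s0 * (j%:R / N.+1%:R) <= s0.
    move=> jN; rewrite mulr_ge0 ?(ltW s00) ?divr_ge0//=.
    by rewrite ler_piMr ?(ltW s00)// ler_pdivrMr// mul1r ler_nat.
  apply: (step _ (s0 * (k%:R / N.+1%:R))); rewrite ?bd ?(ltnW kN)//; last exact: IH (ltnW kN).
  have -> : s0 * (k.+1%:R / N.+1%:R) - s0 * (k%:R / N.+1%:R) = s0 / N.+1%:R.
    by rewrite -[k.+1%:R]natr1; ring.
  rewrite ger0_norm ?divr_ge0 ?(ltW s00)//.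
  by rewrite mulrA ler_pdivrMr//; move: NP; lra.
have [m mP] : P s0 by have := PN _ (leqnn _); rewrite divff ?gt_eqF// mulr1.
exists (2 ^ m)%N; first by rewrite expn_gt0.
move=> x; have := mP x; rewrite /dyadic_power nrmZ cabsX cabs_real gtr0_norm//.
rewrite /s0 exprVn mulrC ler_pdivrMr ?exprn_gt0// => /le_trans; apply.
rewrite mulrC ler_wpM2l ?exprn_ge0 ?(ltW rho0)//.
by rewrite ler_piMl ?nrm_ge0// invf_le1// ler1n.
Qed.

End SpectralRadius.

(** * Rota's similarity and the comparison of spectral radius with norms *)

Section Rota.
Context {R : realType} {H : completeNormedModType R[i]}.
Variable dot : {dot H for Num.conj}.
Hypothesis dot_norm : forall x : H, `|x| ^+ 2 = dot x x.
Implicit Types (x y : H) (T X : H -> H).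

Local Notation rdot := (rdot dot).
Local Notation positive_op := (positive_op dot).

(** The inverse Q of P = X^2 gives the right inverse X Q of X; it is also a left inverse because Q
    cancels X^2 on both sides. *)
Lemma positive_coercive_inverse X (P : H -> H) : positive_op X -> X \o X = P ->
  (forall x, nrm x ^+ 2 <= rdot (P x) x) -> exists S, inverse_ops X S.
Proof.
move=> /positive_opP[bX _ _] XX Pc.
have bP : bounded_op P by rewrite -XX; exact: bounded_op_comp.
have [|Q [_ bQ PQ QP]] := coercive_inverse dot_norm bP ltr01.
  by move=> x; rewrite mul1r.
have XXQ x : X (X (Q x)) = x by have := congr1 (@^~ x) PQ; rewrite -XX.
have QXX x : Q (X (X x)) = x by have := congr1 (@^~ x) QP; rewrite -XX.
exists (X \o Q); split => //; first exact: bounded_op_comp.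
  by apply/funext => x /=; rewrite XXQ.
by apply/funext => x /=; rewrite -[X (Q (X x))]QXX XXQ QXX.
Qed.

(* The norm (sum_(k < n) |T^k x|^2 / rho^2k)^(1/2) decreases by a factor rho
   under T, and is x |-> |X x| for the square root X of a positive operator. *)
Lemma similarity_norm_le T (rho : R) n : bounded_op T -> 0 < rho -> (0 < n)%N ->
  (forall x, nrm (iter n T x) <= rho ^+ n * nrm x) ->
  exists X Xinv, inverse_ops X Xinv /\ opnorm (X \o T \o Xinv) <= rho.
Proof.
move=> bT rho0 n0 Tn; have [bS TS] := adjointP dot_norm bT.
set S := adjoint dot T in bS TS.
have TSk k x y : rdot (iter k S x) y = rdot x (iter k T y).
  by elim: k x y => //= k IH x y; rewrite rdotC -TS rdotC IH -iterSr.
pose c k : R := rho ^- k ^+ 2.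
pose P m x := \sum_(k < m) (c k)%:C *: iter k S (iter k T x).
have bP m : bounded_op (P m).
  elim: m => [|m IH].
    apply/bounded_opP; split; first by move=> a x y; rewrite /P !big_ord0 scaler0 addr0.
    by exists 0 => // x; rewrite /P big_ord0 nrm0 mul0r.
  have := bounded_opD (c m)%:C IH
    (bounded_op_comp (bounded_op_iter m bS) (bounded_op_iter m bT)).
  by congr bounded_op; apply/funext => x; rewrite /P big_ord_recr.
pose d x k := (rho ^- k * nrm (iter k T x)) ^+ 2.
have Pd m x : rdot (P m x) x = \sum_(k < m) d x k.
  rewrite /P rdot_suml; apply: eq_bigr => k _.
  by rewrite rdotZl TSk rdotxx// -exprMn.
have pP : positive_op (P n).
  apply/positive_opP; split=> // [x y|x].
    rewrite /P rdot_suml [RHS]rdotC rdot_suml; apply: eq_bigr => k _.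
    by rewrite !rdotZl !TSk rdotC.
  by rewrite Pd sumr_ge0// => k _; exact: sqr_ge0.
have [X [pX XX]] := positive_sqrt dot_norm pP.
have [bX sX _] := (positive_opP _ _).1 pX.
have [x|Xinv XV] := positive_coercive_inverse pX XX.
  (* The term of index 0 is |x|^2, which makes the operator coercive with constant 1. *)
  rewrite Pd; case: (n) n0 => // m _; rewrite big_ord_recl.
  by rewrite /d expr0 invr1 mul1r lerDl sumr_ge0// => k _; exact: sqr_ge0.
exists X, Xinv; split => //; have [_ bV XVid _] := XV.
have Xd x : nrm (X x) ^+ 2 = \sum_(k < n) d x k.
  by rewrite -Pd -(rdotxx dot_norm) -sX -XX.
have contr x : nrm (X (T x)) <= rho * nrm (X x).
  rewrite -(@ler_pXn2r _ 2)// ?nnegrE ?mulr_ge0 ?nrm_ge0 ?(ltW rho0)//.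
  rewrite exprMn !Xd.
  have -> : \sum_(k < n) d (T x) k = rho ^+ 2 * \sum_(k < n) d x k.+1.
    rewrite mulr_sumr; apply: eq_bigr => k _; rewrite /d -iterSr -exprMn.
    by rewrite mulrA [rho ^+ k.+1]exprS invfM mulrA divff ?mul1r// gt_eqF.
  rewrite ler_wpM2l ?sqr_ge0//.
  (* Replacing x by T x shifts the sum by one index: it loses the term of index 0 and gains that of
     index n, and the hypothesis on T^n compares exactly these two. *)
  have dn : d x n <= d x 0%N.
    rewrite /d expr0 invr1 mul1r ler_pXn2r ?nnegrE ?mulr_ge0 ?invr_ge0 ?exprn_ge0 ?nrm_ge0 ?(ltW rho0)//.
    by rewrite mulrC ler_pdivrMr ?exprn_gt0// mulrC Tn.
  have := big_ord_recl n (fun k => d x k) : _ = _ + \sum_(k < n) d x k.+1.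
  rewrite (big_ord_recr n (fun k => d x k)) /=.
  by move: dn; lra.
apply: opnorm_le; rewrite ?(ltW rho0)//.
  exact: bounded_op_lin (bounded_op_comp (bounded_op_comp bX bT) bV).
move=> y /=; rewrite (le_trans (contr _))//.
by have /= -> := congr1 (@^~ y) XVid.
Qed.

Lemma spectral_radius_ge T (z : R[i]) : bounded_op T -> spectrum T z ->
  cabs z <= spectral_radius T.
Proof.
move=> bT sz; apply: ub_le_sup; last by exists z.
exists (opnorm T) => _ [w sw <-].
exact: spectrum_bound bT (opnorm_ge0 bT) (opnorm_bd bT) sw.
Qed.

(** The convention that [sup] of the empty set is 0 settles the case of an empty spectrum. *)
Lemma spectral_radius_empty T : ~ (exists z, spectrum T z) -> spectral_radius T = 0.
Proof.
move=> no; rewrite /spectral_radius (_ : [set _ | _ in _]%classic = set0) ?sup0//.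
by apply/seteqP; split=> // y [z sz _]; case: no; exists z.
Qed.

Lemma spectral_radius_ge0 T : bounded_op T -> 0 <= spectral_radius T.
Proof.
move=> bT; have [[z sz]|no] := pselect (exists z, spectrum T z).
  exact: le_trans (cabs_ge0 z) (spectral_radius_ge bT sz).
by rewrite spectral_radius_empty.
Qed.

(** The point z = 0 is left out of the hypothesis to match [spectrum_comm], which transfers nonzero
    points only. *)
Lemma spectral_radius_le T (M : R) : 0 <= M ->
  (forall z, z != 0 -> spectrum T z -> cabs z <= M) -> spectral_radius T <= M.
Proof.
move=> M0 TM; have [[z sz]|no] := pselect (exists z, spectrum T z).
  apply: sup_le_ub; first by exists (cabs z), z.
  move=> _ [w sw <-]; have [->|w0] := eqVneq w 0; first by rewrite normr0.
  exact: TM.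
by rewrite spectral_radius_empty.
Qed.

Lemma spectral_radius_le_opnorm T : bounded_op T -> spectral_radius T <= opnorm T.
Proof.
move=> bT; apply: spectral_radius_le; first exact: opnorm_ge0.
by move=> z _; apply: spectrum_bound (opnorm_bd bT) => //; exact: opnorm_ge0.
Qed.

Lemma iter_aluthge_bounded (lambda : R) T n : 0 <= lambda <= 1 -> bounded_op T ->
  bounded_op (iter n (aluthge dot lambda) T).
Proof. by move=> l01 bT; elim: n => //= n IH; exact: aluthge_bounded. Qed.

Lemma spectral_radius_le_aluthge (lambda : R) T X Xinv n : 0 <= lambda <= 1 ->
  bounded_op T -> inverse_ops X Xinv ->
  spectral_radius T <= opnorm (iter n (aluthge dot lambda) (X \o T \o Xinv)).
Proof.
move=> l01 bT [bX bV _ VX].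
have bXT : bounded_op (X \o T) by exact: bounded_op_comp.
have bXTV : bounded_op (X \o T \o Xinv) by exact: bounded_op_comp.
have bn k := iter_aluthge_bounded k l01 bXTV.
apply: spectral_radius_le; first exact: opnorm_ge0.
move=> z z0 sz; apply: spectrum_bound (opnorm_bd (bn n)) _; rewrite ?opnorm_ge0//.
elim: n => [|n IH]; last by apply: spectrum_aluthge => //; exact: bn.
(* Similarity is a swap of factors: T = X^-1 (X T), and the other order is (X T) X^-1. *)
apply: (spectrum_comm bV bXT z0).
by rewrite compA -[Xinv \o _]compA VX.
Qed.

Lemma opnorm_le_spectral_radius (lambda : R) T : 0 <= lambda <= 1 -> bounded_op T ->
  (forall X Xinv : H -> H, inverse_ops X Xinv ->
     opnorm T <= opnorm (aluthge dot lambda (X \o T \o Xinv))) ->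
  opnorm T <= spectral_radius T.
Proof.
move=> l01 bT TX; apply/ler_addgt0Pr => e e0.
have rho0 : 0 < spectral_radius T + e by rewrite ltr_wpDl ?spectral_radius_ge0.
have [z zr sz|n n0 Tn] := power_decay bT rho0.
  by have := spectral_radius_ge bT sz; lra.
have [X [Xinv [XV XTV]]] := similarity_norm_le bT rho0 n0 Tn.
apply: le_trans (TX _ _ XV) (le_trans _ XTV).
case: XV => bX bV _ _; apply: opnorm_aluthge => //.
exact: bounded_op_comp (bounded_op_comp bX bT) bV.
Qed.

End Rota.

Theorem corollary2p2 (R : realType) (H : completeNormedModType R[i])
    (dot : {dot H for Num.conj}) (dot_norm : forall x : H, `|x| ^+ 2 = dot x x)
    (H_neq0 : exists x : H, x != 0)
    (lambda : R) (lambda01 : 0 <= lambda <= 1)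
    (T : H -> H) (T_bounded : bounded_op T) :
  [<-> (* (i) *)
       normaloid T;
       (* (ii) *)
       forall X Xinv : H -> H, inverse_ops X Xinv ->
         opnorm T <= opnorm (aluthge dot lambda (X \o T \o Xinv));
       (* (iii) *)
       forall X Xinv : H -> H, inverse_ops X Xinv -> forall n : nat,
         opnorm T <= opnorm (iter n (aluthge dot lambda) (X \o T \o Xinv))].
Proof.
have i_iii (X Xinv : H -> H) n : normaloid T -> inverse_ops X Xinv ->
    opnorm T <= opnorm (iter n (aluthge dot lambda) (X \o T \o Xinv)).
  by move=> <-; exact: spectral_radius_le_aluthge.
have ii_i : (forall X Xinv : H -> H, inverse_ops X Xinv ->
    opnorm T <= opnorm (aluthge dot lambda (X \o T \o Xinv))) -> normaloid T.
  move=> TX; apply/le_anti; rewrite spectral_radius_le_opnorm//=.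
  exact: opnorm_le_spectral_radius TX.
(* The cycle asked for is (i), (ii), (iii), (i), so the step from (ii) to (iii) passes through (i);
   statement (iii) at n = 1 is (ii). *)
tfae=> [Tn X Xinv XV|TX X Xinv XV n|TX].
- exact: (i_iii X Xinv 1%N).
- exact: i_iii (ii_i TX) XV.
- by apply: ii_i => X Xinv XV; exact: TX XV 1%N.
Qed.
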